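(* Fix $k\ge2$, $\eta\in[0,1)$ and $0<c<\overline c_k(\eta)$. Let $G_n=(V_n,E_n)$ be a sequence of asymptotically tree-like and approximately regular $k$-uniform hypergraphs with maximum degree $\Delta=\Delta(n)$, and suppose $p\sim c\Delta^{-\frac1{k-1}}$. Then $$\lim_{n\to\infty}\Delta^{\frac1{k-1}}|V_n|^{-1}\log\mathbb{P}_p(\mathbf X\le\eta\,\mathbb{E}\mathbf X)=x^\ast+(x^\ast)^k\left(1-\frac1k\right)\zeta-\log(1-\zeta)\frac{\eta c^k}{k}-c,$$ where $\zeta$ is the unique solution in $[0,1]$ of $(1-\zeta)(x_k^\ast(c,\zeta))^k=\eta c^k$ and $x^\ast=x_k^\ast(c,\zeta)$ (for $\eta=0$, $\zeta=1$ and the term $\log(1-\zeta)\eta c^k/k$ is interpreted as $0$). In particular, if $c<\left(\frac e{k-1}\right)^{\frac1{k-1}}$ and $p\sim c\Delta^{-\frac1{k-1}}$, then $$\lim_{n\to\infty}\Delta^{\frac1{k-1}}|V_n|^{-1}\log\mathbb{P}_p(\mathbf X=0)=x^\ast+\left(1-\frac1k\right)(x^\ast)^k-c,\quad x^\ast=x_k^\ast(c,1).$$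
   Context: Hypergraphs are simple. For a hypergraph $G$ and $S\subseteq V(G)$, $d_G(S)=|\{e\in E(G):S\subseteq e\}|$, $\Delta_\ell(G)=\max_{|S|=\ell}d_G(S)$, $\Delta(G)=\Delta_1(G)$ the maximum degree, $\delta(G)$ the minimum degree, and $\Gamma(G)$ is the maximum over distinct $v,v'$ of the number of $(k-1)$-sets $S$ with $S\cup\{v\},S\cup\{v'\}\in E(G)$. A sequence $(G_n)$ of $k$-uniform hypergraphs is asymptotically tree-like if, with $G=G_n$, $\Delta=\Delta(G)$, as $n\to\infty$: (1) $\Delta\to\infty$; (2) $\Delta_\ell(G)=o(\Delta^{\frac{k-\ell}{k-1}})$ for each $\ell\in\{2,\dots,k-1\}$; (3) $\Gamma(G)=o(\Delta)$; (4) $|E(G)|/|V(G)|=\Omega(\Delta)$. It is approximately regular if also $\delta(G)=(1-o(1))\Delta(G)$. $V_p$ is a random subset of $V_n$ including each vertex independently with probability $p$, $\mathbf X=|\{e\in E_n:e\subseteq V_p\}|$, so $\mathbb{E}\mathbf X=|E_n|p^k$. $W$ is the Lambert $W$ function; $x_k^\ast(c,\zeta)=\left(\frac{W((k-1)c^{k-1}\zeta)}{(k-1)\zeta}\right)^{\frac1{k-1}}$ for $\zeta\in(0,1]$ and $x_k^\ast(c,0)=c$. $\eta_k^\ast=e^{-k/(k-1)}$; $\overline c_k(\eta)=\left(\frac{e}{(k-1)(1-\eta/\eta_k^\ast)}\right)^{\frac1{k-1}}$ if $\eta<\eta_k^\ast$ and $+\infty$ otherwise. *)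

(* Defs.v *)
From HB Require Import structures.
From mathcomp Require Import all_boot all_order all_algebra.
From mathcomp Require Import all_classical all_reals all_analysis.
Set Implicit Arguments. Unset Strict Implicit. Unset Printing Implicit Defensive.
Import Order.TTheory GRing.Theory Num.Theory.
Local Open Scope classical_set_scope.
Local Open Scope ring_scope.

Section Hyper.
Variable N : nat.
Variable E : {set {set 'I_N}}.

Definition uniform (k : nat) : bool := [forall e in E, #|e| == k].

Definition codeg (S : {set 'I_N}) : nat := #|[set e in E | S \subset e]|.

Definition maxcodeg (l : nat) : nat := \max_(S : {set 'I_N} | #|S| == l) codeg S.

Definition maxdeg : nat := maxcodeg 1.

Definition mindeg : nat := \big[minn/maxdeg]_(v : 'I_N) codeg [set v].

Definition Gamma (k : nat) : nat :=
  \max_(vv : 'I_N * 'I_N | vv.1 != vv.2)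
     #|[set S : {set 'I_N} | (#|S| == k.-1) && (vv.1 |: S \in E) && (vv.2 |: S \in E)]|.

Definition Xcount (S : {set 'I_N}) : nat := #|[set e in E | e \subset S]|.

Definition probXle (R : realType) (p t : R) : R :=
  \sum_(S : {set 'I_N}) (if (Xcount S)%:R <= t then p ^+ #|S| * (1 - p) ^+ (N - #|S|) else 0).

Definition probX0 (R : realType) (p : R) : R :=
  \sum_(S : {set 'I_N}) (if Xcount S == 0%N then p ^+ #|S| * (1 - p) ^+ (N - #|S|) else 0).
End Hyper.

Section Reals.
Variable R : realType.

Definition lambertW (y : R) : R := xget 0 [set x : R | 0 <= x /\ x * expR x = y].

Definition xstar (k : nat) (c zeta : R) : R :=
  if zeta == 0 then c
  else powR (lambertW (k.-1%:R * c ^+ k.-1 * zeta) / (k.-1%:R * zeta)) (k.-1%:R^-1).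

Definition eta_star (k : nat) : R := expR (- (k%:R / k.-1%:R)).

(* c < \overline c_k(eta)   (\overline c_k(eta) = +oo when eta >= eta_k^* ) *)
Definition lt_cbar (k : nat) (eta c : R) : Prop :=
  eta < eta_star k ->
  c < powR (expR 1 / (k.-1%:R * (1 - eta / eta_star k))) (k.-1%:R^-1).
End Reals.

(* Main.v *)
Require Import Defs.
From HB Require Import structures.
From mathcomp Require Import all_boot all_order all_algebra.
From mathcomp Require Import all_classical all_reals all_analysis.
From mathcomp Require Import ring lra zify.
Import Order.TTheory GRing.Theory Num.Theory.
Import numFieldNormedType.Exports.
Set Implicit Arguments. Unset Strict Implicit. Unset Printing Implicit Defensive.
Local Open Scope ring_scope.

(* The Gibbs measure mu(S) ~ lam^|S| (1 - zeta)^X(S) with lam = s Delta^(-1/(k-1)) is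
   analysed by a recursion on pinned instances: fix the state of a bounded set A of
   vertices and delete some edges meeting A. The ratio Z(A + u) / Z(A) is a product, over
   the edges e at u, of factors 1 - zeta P(e - u is occupied), and P(e - u is occupied) is
   in turn a product of k - 1 occupation probabilities in instances with a slightly larger
   A. The codegree conditions make all but o(Delta) of the edges at u generic. Hence, if
   a <= Z(A + u) / Z(A) <= b asymptotically for all instances with bounded A, then also
   h(b) <= Z(A + u) / Z(A) <= h(a), where h(t) = exp (- zeta (s t)^(k-1)). As
   (k-1) zeta s^(k-1) < e, the map h o h has a unique fixed point, so every vertex is
   occupied with probability ~ x Delta^(-1/(k-1)), where x exp (zeta x^(k-1)) = s.

   Integrating the density in s gives the free energy x + (1 - 1/k) zeta x^k. The
   exponential Markov inequality then yields the upper bound on P(X <= eta E X); for the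
   lower bound one tilts by a slightly larger zeta', and strict convexity of the free
   energy in ln (1 - zeta') confines X to a window just below eta E X. *)

(** * Partition functions with pinned vertices *)

(** Why [e]: at its fixed point [h] has slope [- y] with [y = (k-1) zeta x^(k-1)], and
    [y e^y = (k-1) zeta s^(k-1)], so the condition says exactly [y < 1]. For [s = c] and the [zeta]
    of the theorem it follows from the bound on [c].

    The two directions of the recursion treat non-generic edges differently. For an upper bound on
    the ratio they are discarded, since removing edges only increases [Z]. For a lower bound they
    must be kept; each is charged the full weight of its free vertices, and these weights sum to
    [o(1)]. The case [zeta = 1], which is the event [X = 0], is included throughout; there a
    completed edge annihilates the weight, hence no edge of an instance may lie inside the pinned
    set.

    No derivative of [ln Z] is taken: [ln Z] and the free energy are both convex in [ln s] with
    asymptotically equal slopes, so they are compared along a fine grid from a negligible starting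
    value.

    The lower bound on the tail loses constant factors. They are harmless because [D / N] tends to
    0, which is extracted from near-regularity together with the codegree conditions, or with
    [Gamma] when [k = 2]. *)

Section PartitionFunction.
Variables (R : realType) (N : nat) (lam zeta : R).
Hypotheses (lam_ge0 : 0 <= lam) (zeta01 : 0 <= zeta <= 1).
Implicit Types (A B S e : {set 'I_N}) (F G : {set {set 'I_N}}).

(* The vertices of A count as occupied for the edges of F; a vertex is deleted by pinning
   it and removing its edges from F. *)
Definition pf A F : R :=
  \sum_(S : {set 'I_N} | [disjoint S & A])
     lam ^+ #|S| * (1 - zeta) ^+ Xcount F (S :|: A).

Lemma sum_supersets (h : {set 'I_N} -> R) A B : [disjoint B & A] ->
  \sum_(S : {set 'I_N} | [disjoint S & A] && (B \subset S)) h S =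
  \sum_(S : {set 'I_N} | [disjoint S & A :|: B]) h (B :|: S).
Proof.
move=> dBA.
rewrite (reindex_onto (fun S => B :|: S) (fun S => S :\: B)); last first.
  by move=> S /andP[_ BS]; rewrite -{2}(finset.setID S B) (finset.setIidPr BS).
apply: eq_bigl => S; rewrite finset.subsetUl andbT !finset.disjoints_subset.
rewrite finset.subUset -finset.disjoints_subset dBA /= finset.setCU finset.subsetI.
congr andb; rewrite finset.setDUl finset.setDv finset.set0U.
by rewrite -finset.disjoints_subset; apply/eqP/idP; move/finset.setDidPl.
Qed.

Lemma Xcount_setU1 e F S : e \notin F ->
  Xcount (e |: F) S = ((e \subset S) + Xcount F S)%N.
Proof.
move=> eF; rewrite /Xcount; case: (boolP (e \subset S)) => [eS|eS].
  rewrite (_ : [set e0 in e |: F | e0 \subset S]%SET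
     = e |: [set e0 in F | e0 \subset S]%SET).
    by rewrite finset.cardsU1 inE (negbTE eF) eS.
  apply/setP => g; rewrite !inE; case: eqVneq => [->|//].
  by rewrite eS.
rewrite add0n; congr #|pred_of_set _|; apply/setP => g; rewrite !inE.
by case: eqVneq => [->|//]; rewrite (negbTE eF) (negbTE eS).
Qed.

Lemma sub_Xcount F G S : F \subset G -> (Xcount F S <= Xcount G S)%N.
Proof.
move=> FG; apply: subset_leq_card; apply/fintype.subsetP => g; rewrite !inE => /andP[gF ->].
by rewrite (fintype.subsetP FG).
Qed.

Let zc01 : 0 <= 1 - zeta <= 1.
Proof. by move: zeta01 => /andP[? ?]; apply/andP; split; lra. Qed.

Lemma pf_ge0 A F : 0 <= pf A F.
Proof.
by apply: sumr_ge0 => S _; rewrite mulr_ge0 // exprn_ge0 //; case/andP: zc01.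
Qed.

Lemma pf_le_edges A F G : F \subset G -> pf A G <= pf A F.
Proof.
move=> FG; apply: ler_sum => S _; rewrite ler_wpM2l ?exprn_ge0 //.
case/andP: zc01 => z0 z1.
by rewrite ler_wiXn2l // sub_Xcount.
Qed.

(** If [u] is unoccupied, no edge at [u] is complete, so [u] may count as pinned in the instance
    without its edges. Both terms then have the same pinned set and differ only in the edges at
    [u]. *)
Lemma pf_vertex A F u : u \notin A ->
  pf A F = pf (u |: A) [set e in F | u \notin e]%SET + lam * pf (u |: A) F.
Proof.
move=> uA; rewrite {1}/pf (bigID (fun S => [set u]%SET \subset S)) /= addrC.
congr (_ + _).
  apply: eq_big => [S|S].
    rewrite finset.sub1set !finset.disjoints_subset finset.setCU finset.subsetI andbC.
    by congr andb; rewrite -finset.disjoints_subset disjoint_sym finset.disjoints1.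
  rewrite finset.sub1set => /andP[_ uS]; congr (_ * _ ^+ _).
  rewrite /Xcount; congr #|pred_of_set _|; apply/setP => g; rewrite !inE.
  rewrite -andbA; congr andb; apply/idP/idP => [gS|/andP[ug /fintype.subsetP gS]].
    have -> : u \notin g.
      apply/negP => ug; move/fintype.subsetP: gS => /(_ _ ug).
      by rewrite inE (negbTE uS) (negbTE uA).
    apply: (fintype.subset_trans gS); apply/fintype.subsetP => x; rewrite !inE.
    by case/orP => ->; rewrite ?orbT.
  apply/fintype.subsetP => x xg; have := gS _ xg; rewrite !inE.
  by case: eqVneq => // xu; rewrite -xu xg in ug.
rewrite sum_supersets; last first.
  by rewrite finset.disjoints1.
rewrite mulr_sumr (finset.setUC A).
apply: eq_bigr => S; rewrite disjoint_sym finset.disjoints_subset => /fintype.subsetP uS.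
have nuS : u \notin S by have := uS u; rewrite !inE eqxx => /(_ isT).
rewrite finset.cardsU1 nuS add1n exprS mulrA; congr (_ * _ ^+ Xcount _ _).
by rewrite finset.setUCA finset.setUA.
Qed.

(** The factor of [e] is 1 minus [zeta] times the indicator that [e] is occupied; forcing the free
    vertices of [e] to be occupied costs [lam ^+ #|e :\: A|]. *)
Lemma pf_edge A F e : e \notin F ->
  pf A (e |: F) = pf A F - zeta * lam ^+ #|e :\: A| * pf (A :|: e) F.
Proof.
move=> eF; rewrite -mulrA.
have -> : lam ^+ #|e :\: A| * pf (A :|: e) F = 
  \sum_(S : {set 'I_N} | [disjoint S & A] && (e :\: A \subset S))
     lam ^+ #|S| * (1 - zeta) ^+ Xcount F (S :|: A).
  rewrite sum_supersets; last first.
    by rewrite finset.disjoints_subset finset.subsetDr.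
  rewrite mulr_sumr.
  have -> : A :|: e :\: A = A :|: e.
    by apply/setP => x; rewrite !inE; case: (x \in A).
  apply: eq_bigr => S dS; rewrite finset.cardsU.
  have -> : (e :\: A) :&: S = finset.set0.
    apply/setP => x; rewrite !inE; apply/negP => /andP[/andP[xA xe] xS].
    move/pred0P: dS => /(_ x) /=; rewrite xS /= inE xe orbT; done.
  rewrite finset.cards0 subn0 exprD mulrA; congr (_ * _ ^+ Xcount _ _).
  by apply/setP => x; rewrite !inE; case: (x \in A); case: (x \in S); case: (x \in e).
rewrite /pf big_mkcondr mulr_sumr -sumrB; apply: eq_bigr => S dS.
rewrite Xcount_setU1 // (_ : (e :\: A \subset S) = (e \subset S :|: A)).
  case: (e \subset S :|: A); last by rewrite add0n mulr0 subr0.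
  by rewrite add1n exprS mulrBl mul1r mulrBr (mulrCA zeta).
by rewrite finset.subDset finset.setUC.
Qed.
End PartitionFunction.

(** * Telescoping along chains of sets *)

Section SetChain.
Variables (R : realType) (X : finType) (f : {set X} -> R) (q : X -> R).
Implicit Types (A B C : {set X}) (x : X).
Hypothesis q_ge0 : forall x, 0 <= q x.

(** Serves twice: with vertex sets, to pin the vertices of an edge one by one, and with sets of
    edges, to restore the edges at [u] one by one. *)
Lemma set_chain_ge A B : A \subset B ->
  (forall C x, A \subset C -> C \subset B -> x \in B -> x \notin C ->
     q x * f C <= f (x |: C)) ->
  (\prod_(x in B :\: A) q x) * f A <= f B.
Proof.
elim: {A}_.+1 {-2}A (ltnSn #|B :\: A|) => // n IHn A nBA AB step.
have [AB0|[x]] := finset.set_0Vmem (B :\: A).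
  rewrite AB0 big_set0 mul1r (_ : A = B) //.
  by apply/eqP; rewrite finset.eqEsubset AB -finset.setD_eq0 AB0 eqxx.
rewrite inE => /andP[xA xB].
have BAx : (B :\: A) :\ x = B :\: (x |: A).
  by apply/setP => y; rewrite !inE negb_or andbA.
have xAB : x |: A \subset B by rewrite finset.subUset finset.sub1set xB.
rewrite (big_setD1 x) /=; last by rewrite inE xA.
rewrite BAx -mulrA mulrCA.
apply: le_trans (IHn (x |: A) _ xAB _); last 2 first.
- move: nBA; rewrite (cardsD1 x (B :\: A)) inE xA xB BAx add1n ltnS; exact.
- move=> C y xAC; apply: step; apply: fintype.subset_trans xAC.
  exact: finset.subsetUr.
apply: ler_wpM2l; first exact: prodr_ge0.
by apply: step.
Qed.

Lemma set_chain_le A B : A \subset B ->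
  (forall C x, A \subset C -> C \subset B -> x \in B -> x \notin C ->
     f (x |: C) <= q x * f C) ->
  f B <= (\prod_(x in B :\: A) q x) * f A.
Proof.
elim: {A}_.+1 {-2}A (ltnSn #|B :\: A|) => // n IHn A nBA AB step.
have [AB0|[x]] := finset.set_0Vmem (B :\: A).
  rewrite AB0 big_set0 mul1r (_ : A = B) //.
  by apply/eqP; rewrite finset.eqEsubset AB -finset.setD_eq0 AB0 eqxx.
rewrite inE => /andP[xA xB].
have BAx : (B :\: A) :\ x = B :\: (x |: A).
  by apply/setP => y; rewrite !inE negb_or andbA.
have xAB : x |: A \subset B by rewrite finset.subUset finset.sub1set xB.
rewrite (big_setD1 x) /=; last by rewrite inE xA.
rewrite BAx -mulrA mulrCA.
apply: le_trans (IHn (x |: A) _ xAB _) _.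
- move: nBA; rewrite (cardsD1 x (B :\: A)) inE xA xB BAx add1n ltnS; exact.
- move=> C y xAC; apply: step; apply: fintype.subset_trans xAC.
  exact: finset.subsetUr.
apply: ler_wpM2l; first exact: prodr_ge0.
by apply: step.
Qed.
End SetChain.

(** * One step of the recursion *)

Section Recursion.
Variables (R : realType) (N k : nat) (E : {set {set 'I_N}}) (lam zeta : R).
Hypotheses (lam_ge0 : 0 <= lam) (zeta01 : 0 <= zeta <= 1).
Hypotheses (k_ge2 : (2 <= k)%N) (Eunif : uniform E k).
Implicit Types (A B C S e : {set 'I_N}) (F G : {set {set 'I_N}}).
Local Notation pf := (pf lam zeta).

Let k1_gt0 : (0 < k.-1)%N.
Proof. by rewrite -subn1 subn_gt0. Qed.

Lemma card_edge e : e \in E -> #|e| = k.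
Proof. by move=> eE; move/forallP: Eunif => /(_ e) /implyP /(_ eE) /eqP. Qed.

(* Only edges meeting A may be missing from F. *)
Definition pinned A F : Prop :=
  [/\ F \subset E, (forall e, e \in E -> [disjoint e & A] -> e \in F)
    & (forall e, e \in F -> ~~ (e \subset A))].

Definition upper_ratio (K : nat) (b : R) : Prop :=
  forall A F u, pinned A F -> (#|A| <= K)%N -> u \notin A ->
    pf (u |: A) F <= b * pf A F.

(** The extra hypothesis, absent from [upper_ratio], is forced by [zeta = 1]: an edge of [F] inside
    [u |: A] would make [pf (u |: A) F] vanish. *)
Definition lower_ratio (K : nat) (a : R) : Prop :=
  forall A F u, pinned A F -> (#|A| <= K)%N -> u \notin A ->
    (forall e, e \in F -> ~~ (e \subset u |: A)) ->
    a * pf A F <= pf (u |: A) F.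

Definition nodeleted F (u : 'I_N) := [set e in F | u \notin e]%SET.

Lemma nodeleted_sub F u : nodeleted F u \subset F.
Proof. by apply/fintype.subsetP => e; rewrite inE => /andP[]. Qed.

Lemma pf_vertex_le A F u : u \notin A -> pf (u |: A) F <= pf A F.
Proof.
move=> uA; rewrite (pf_vertex _ _ _ uA) -[leLHS]addr0 lerD //.
  by apply: pf_le_edges => //; exact: nodeleted_sub.
by rewrite mulr_ge0 // pf_ge0.
Qed.

Lemma upper_ratio1 K : upper_ratio K 1.
Proof. by move=> A F u _ _ uA; rewrite mul1r; exact: pf_vertex_le. Qed.

Lemma lower_ratio0 K : lower_ratio K 0.
Proof. by move=> A F u _ _ _ _; rewrite mul0r; exact: pf_ge0. Qed.

Lemma pf_pin_le (b : R) A B F : 0 <= b ->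
  (forall C x, A \subset C -> C \subset A :|: B -> x \in B -> x \notin C ->
     pf (x |: C) F <= b * pf C F) ->
  pf (A :|: B) F <= b ^+ #|B :\: A| * pf A F.
Proof.
move=> b0 step.
have := @set_chain_le R _ (fun C => pf C F) (fun=> b) (fun=> b0) A (A :|: B).
rewrite prodr_const finset.setDUl finset.setDv finset.set0U; apply.
  exact: finset.subsetUl.
move=> C x AC CB xAB xC; apply: step => //.
move: xAB; rewrite inE => /orP[xA|//].
by rewrite (fintype.subsetP AC) in xC.
Qed.

Lemma pf_pin_ge (a : R) A B F : 0 <= a ->
  (forall C x, A \subset C -> C \subset A :|: B -> x \in B -> x \notin C ->
     a * pf C F <= pf (x |: C) F) ->
  a ^+ #|B :\: A| * pf A F <= pf (A :|: B) F.
Proof.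
move=> a0 step.
have := @set_chain_ge R _ (fun C => pf C F) (fun=> a) (fun=> a0) A (A :|: B).
rewrite prodr_const finset.setDUl finset.setDv finset.set0U; apply.
  exact: finset.subsetUl.
move=> C x AC CB xAB xC; apply: step => //.
move: xAB; rewrite inE => /orP[xA|//].
by rewrite (fintype.subsetP AC) in xC.
Qed.

Lemma pf_pin_le1 A B F : pf (A :|: B) F <= pf A F.
Proof.
have := @pf_pin_le 1 A B F ler01; rewrite expr1n mul1r; apply.
by move=> C x _ _ _ xC; rewrite mul1r pf_vertex_le.
Qed.

(* If the vertices of a good edge e are pinned one after another, no edge other than e gets
   completed, so every stage is again a pinned instance. *)
Definition good A u e :=
  [&& e \in E, u \in e, [disjoint e & A] &
   [forall e', [&& e' \in E, e' != e & e' \subset A :|: e] ==> (e' \subset u |: A)]].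

(** Compared with [F], only edges at [u] are missing from [F'], which is allowed because [u] is
    pinned in [C]. Goodness of [e] prevents any other edge from lying in [A :|: e] without lying in
    [u |: A]. *)
Lemma good_pinned A F u e F' C : pinned A F -> good A u e ->
  nodeleted F u \subset F' -> F' \subset F -> e \notin F' ->
  (forall g, g \in F' -> ~~ (g \subset u |: A)) ->
  u |: A \subset C -> C \subset A :|: e ->
  pinned C F' /\ (forall x, x \in e -> forall g, g \in F' -> ~~ (g \subset x |: C)).
Proof.
move=> [FE EF nFA] /and4P[eE ue eA /forallP egood] F0F' F'F eF' nF'A AC Ce.
have adm B : B \subset A :|: e -> forall g, g \in F' -> ~~ (g \subset B).
  move=> BAe g gF'; apply: (contraNN _ (nF'A _ gF')) => gB.
  move: (egood g) => /implyP; apply; apply/and3P; split.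
  - by rewrite (fintype.subsetP FE) // (fintype.subsetP F'F).
  - by apply: (contraNneq _ eF') => <-.
  - exact: fintype.subset_trans BAe.
split; last first.
  move=> x xe; apply: adm; rewrite finset.subUset Ce finset.sub1set.
  by rewrite inE xe orbT.
split; [exact: fintype.subset_trans FE | | exact: adm].
move=> g gE gC; apply: (fintype.subsetP F0F'); rewrite inE.
rewrite EF //=; last first.
  apply: disjointWr gC; apply: fintype.subset_trans AC; exact: finset.subsetUr.
apply/negP => ug; move/pred0P: gC => /(_ u) /=; rewrite ug /=.
by rewrite (fintype.subsetP AC) // finset.setU11.
Qed.

Lemma good_cardD A u e : good A u e -> #|e :\: (u |: A)| = k.-1.
Proof.
move=> /and4P[eE ue eA _].
have -> : e :\: (u |: A) = e :\ u.
  by rewrite finset.setUC -finset.setDDl; move/finset.setDidPl: eA => ->.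
by rewrite -(card_edge eE) (cardsD1 u e) ue.
Qed.

Lemma card_pin A e C K : (#|A| <= K)%N -> e \in E -> C \subset A :|: e ->
  (#|C| <= K + k)%N.
Proof.
move=> AK eE CAe; apply: (leq_trans (subset_leq_card CAe)).
apply: (leq_trans (leq_card_setU _ _)).
by rewrite (card_edge eE) leq_add2r.
Qed.

(** The edges at [u] are restored one at a time, each multiplying the partition function by at least
    [1 - t e]. For a good edge, [t e] comes from [k - 1] uses of the upper ratio, at pinned sets of
    size at most [K + k]; for a bad one only the trivial bound is available, and these add up to
    [theta]. The factor [1 / (1 + lam)] compares [pf A F] with the instance in which [u] has lost
    its edges. *)
Lemma lower_step K (b Dm theta : R) : 0 <= b <= 1 -> lam < 1 ->
  (forall u, (codeg E [set u]%SET)%:R <= Dm) ->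
  (forall A u, (#|A| <= K)%N -> u \notin A ->
     \sum_(e in E | [&& u \in e, ~~ good A u e & ~~ (e \subset u |: A)])
        lam ^+ #|e :\: (u |: A)| <= theta) ->
  upper_ratio (K + k) b ->
  lower_ratio K (expR (- (zeta * (Dm * (lam * b) ^+ k.-1 + theta) / (1 - lam)))
                 / (1 + lam)).
Proof.
move=> /andP[b0 b1] lam1 degD badD UB A F u pinAF AK uA nFuA.
have [FE EF nFA] := pinAF.
have /andP[z0 z1] := zeta01.
set A' := u |: A; set F0 := nodeleted F u.
pose t e := zeta * (if good A u e then (lam * b) ^+ k.-1 else lam ^+ #|e :\: A'|).
have F0A e : e \in F :\: F0 -> u \in e.
  by rewrite !inE negb_and negbK => /andP[/orP[/negbTE->//|//]].
have chain : (\prod_(e in F :\: F0) expR (- (t e / (1 - lam)))) * pf A' F0 <= pf A' F.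
  apply: (@set_chain_ge R _ (fun F => pf A' F)) (nodeleted_sub F u) _.
    by move=> e; exact: expR_ge0.
  move=> F' e F0F' F'F eF eF'.
  have eE : e \in E by exact: (fintype.subsetP FE).
  have ue : u \in e by apply: F0A; rewrite inE eF (contraNN _ eF') // => /(fintype.subsetP F0F').
  have tlam : t e <= lam.
    rewrite /t; case: ifP => [eg|_].
      apply: (@le_trans _ _ (1 * lam)); last by rewrite mul1r.
      rewrite ler_pM ?exprn_ge0 ?mulr_ge0 //.
      have lb1 : lam * b <= lam by rewrite ler_piMr.
      apply: le_trans (lb1); apply: ler_iXnr; first exact: k1_gt0.
        exact: mulr_ge0.
      exact: le_trans lb1 (ltW lam1).
    apply: (@le_trans _ _ (1 * lam)); last by rewrite mul1r.
    rewrite ler_pM ?exprn_ge0 //.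
    rewrite ler_iXnr ?lam_ge0 ?(ltW lam1) //.
    by rewrite card_gt0 finset.setD_eq0 nFuA.
  have t0 : 0 <= t e.
    by rewrite /t; case: ifP => _; rewrite mulr_ge0 // exprn_ge0 // mulr_ge0.
  have : (1 - t e) * pf A' F' <= pf A' (e |: F').
    rewrite pf_edge // mulrBl mul1r lerD2l lerN2 -mulrA /t -mulrA ler_wpM2l //.
    case: ifP => [eg|_]; last first.
      by rewrite ler_wpM2l ?exprn_ge0 // pf_pin_le1.
    rewrite exprMn -mulrA (good_cardD eg) ler_wpM2l ?exprn_ge0 //.
    rewrite -(good_cardD eg); apply: pf_pin_le => // C x AC CAe xe xC.
    have CAe' : C \subset A :|: e.
      apply: (fintype.subset_trans CAe); rewrite !finset.subUset.
      by rewrite finset.sub1set inE ue orbT finset.subsetUl finset.subsetUr.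
    have [pC _] := good_pinned pinAF eg F0F' F'F eF'
      (fun g gF' => nFuA g (fintype.subsetP F'F _ gF')) AC CAe'.
    apply: UB => //.
    exact: card_pin CAe'.
  apply: le_trans; apply: ler_wpM2r; first exact: pf_ge0.
  have l1 : 0 < 1 - lam by lra.
  have t1 : 0 < 1 - t e by lra.
  (* [1 / (1 - t) = 1 + t / (1 - t) <= exp (t / (1 - t))], and [t <= lam] allows [1 - lam] in the
     denominator. *)
  rewrite expRN -[leRHS]invrK lef_pV2 ?posrE ?expR_gt0 ?invr_gt0 //.
  apply: (@le_trans _ _ (expR (t e / (1 - t e)))); last first.
    by rewrite ler_expR ler_wpM2l // lef_pV2 ?posrE //; lra.
  apply: le_trans (expR_ge1Dx _).
  rewrite le_eqVlt; apply/orP; left; apply/eqP; field; lra.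
rewrite (pf_vertex _ _ _ uA) -/F0 -/A'.
set T := _ / (1 - lam).
have sumt : \sum_(e in F :\: F0) t e <= zeta * (Dm * (lam * b) ^+ k.-1 + theta).
  rewrite -mulr_sumr ler_wpM2l //.
  rewrite (bigID (good A u)) /=; apply: lerD.
    rewrite (eq_bigr (fun=> (lam * b) ^+ k.-1)); last by move=> e /andP[_ ->].
    rewrite sumr_const -[X in X *+ _]mul1r -mulrnAl ler_wpM2r ?exprn_ge0 ?mulr_ge0 //.
    apply: le_trans (degD u); rewrite ler_nat; apply: subset_leq_card.
    apply/fintype.subsetP => e; rewrite unfold_in => /andP[/[dup] eFF0 /F0A ue _].
    rewrite inE finset.sub1set ue andbT; apply: (fintype.subsetP FE).
    by move: eFF0; rewrite inE => /andP[].
  apply: le_trans (badD _ _ AK uA).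
  rewrite [leRHS]big_mkcond [leLHS]big_mkcond /=; apply: ler_sum => e _.
  case: ifP => [/andP[eFF0 /negbTE->]|_].
    have eF : e \in F by move: eFF0; rewrite inE => /andP[].
    by rewrite (fintype.subsetP FE) //= (F0A _ eFF0) nFuA.
  by case: ifP => _ //; exact: exprn_ge0.
have Tle : (\sum_(e in F :\: F0) t e) / (1 - lam) <= T.
  by rewrite ler_wpM2r // invr_ge0; lra.
have X0 : 0 <= pf A' F0 by exact: pf_ge0.
have XF : pf A' F <= pf A' F0 by exact: pf_le_edges (nodeleted_sub F u).
apply: (@le_trans _ _ (expR (- T) * pf A' F0)).
  rewrite -mulrA ler_wpM2l ?expR_ge0 // ler_pdivrMl; last by rewrite ltr_pwDl.
  by rewrite mulrDl mul1r lerD2l ler_wpM2l.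
apply: le_trans chain; rewrite ler_wpM2r // -expR_sum ler_expR.
by rewrite sumrN lerN2 -mulr_suml.
Qed.

(** Dropping the bad edges only increases [pf (u |: A) F], so a lower bound [g] on the number of
    good edges suffices. Their factors are bounded through [1 - t <= exp (- t)]. *)
Lemma upper_step K (a g : R) : 0 <= a ->
  (forall A u, (#|A| <= K)%N -> u \notin A ->
     g <= #|[set e in E | good A u e]%SET|%:R) ->
  lower_ratio (K + k) a ->
  upper_ratio K (expR (- (zeta * (g * (lam * a) ^+ k.-1)))).
Proof.
move=> a0 goodD LB A F u pinAF AK uA.
have [FE EF nFA] := pinAF.
have /andP[z0 z1] := zeta01.
set A' := u |: A; set F0 := nodeleted F u.
set H := [set e in E | good A u e]%SET.
have HF : H \subset F.
  apply/fintype.subsetP => e; rewrite inE => /andP[eE /and4P[_ _ eA _]]; exact: EF.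
have F0H : F0 \subset F0 :|: H by exact: finset.subsetUl.
have HF0 : (F0 :|: H) :\: F0 = H.
  rewrite finset.setDUl finset.setDv finset.set0U; apply/finset.setDidPl.
  apply/pred0P => e /=; rewrite !inE; apply/negP.
  by case/andP => /andP[_ /and4P[_ -> _ _]]; rewrite andbF.
pose q := expR (- (zeta * (lam * a) ^+ k.-1)).
have FH : F0 :|: H \subset F by rewrite finset.subUset HF nodeleted_sub.
have nHA g' : g' \in F0 :|: H -> ~~ (g' \subset A').
  rewrite !inE => /orP[/andP[gF ug]|/andP[gE /and4P[_ ug gA _]]].
    apply: (contraNN _ (nFA _ gF)) => /fintype.subsetP gA'.
    apply/fintype.subsetP => x xg; move: (gA' _ xg); rewrite !inE.
    by case: eqVneq => // xu; rewrite -xu xg in ug.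
  (* A good edge avoids [A], so inside [u |: A] it would have at most one vertex, against
     [k >= 2]. *)
  apply/negP => gA'; have : (#|g'| <= #|[set u]%SET|)%N.
    apply: subset_leq_card; apply/fintype.subsetP => x xg.
    move: (fintype.subsetP gA' _ xg); rewrite !inE => /orP[->//|xA].
    by move/pred0P: gA => /(_ x) /=; rewrite xg xA.
  by rewrite (card_edge gE) cards1 leqNgt k_ge2.
have chain : pf A' (F0 :|: H) <= (\prod_(e in H) q) * pf A' F0.
  have := @set_chain_le R _ (fun F => pf A' F) (fun=> q) (fun=> expR_ge0 _) _ _ F0H.
  rewrite HF0; apply.
  move=> F' e F0F' F'F eFH eF'.
  have eg : good A u e.
    move: eFH; rewrite inE; case: (boolP (e \in F0)) => [|_ /=].
      by move=> /(fintype.subsetP F0F'); rewrite (negbTE eF').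
    by rewrite inE => /andP[].
  have /and4P[eE ue eA _] := eg.
  have : pf A' (e |: F') <= (1 - zeta * (lam * a) ^+ k.-1) * pf A' F'.
    rewrite pf_edge // mulrBl mul1r lerD2l lerN2 -!mulrA ler_wpM2l //.
    rewrite exprMn -mulrA (good_cardD eg) ler_wpM2l ?exprn_ge0 //.
    rewrite -(good_cardD eg); apply: pf_pin_ge => // C x AC CAe xe xC.
    have CAe' : C \subset A :|: e.
      apply: (fintype.subset_trans CAe); rewrite !finset.subUset.
      by rewrite finset.sub1set inE ue orbT finset.subsetUl finset.subsetUr.
    have [pC nC] := good_pinned pinAF eg F0F' (fintype.subset_trans F'F FH) eF'
      (fun g gF' => nHA g (fintype.subsetP F'F _ gF')) AC CAe'.
    apply: LB => //; last exact: nC.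
    exact: card_pin CAe'.
  move=> /le_trans; apply; apply: ler_wpM2r; first exact: pf_ge0.
  exact: expR_ge1Dx.
apply: (@le_trans _ _ (pf A' (F0 :|: H))); first exact: pf_le_edges.
apply: (le_trans chain).
rewrite (pf_vertex _ _ _ uA) -/F0 -/A' mulrDr -[leLHS]addr0; apply: lerD; last first.
  by rewrite !mulr_ge0 ?expR_ge0 // pf_ge0.
apply: ler_wpM2r; first exact: pf_ge0.
rewrite prodr_const /q -expRM_natl ler_expR mulrN lerN2 [leRHS]mulrCA.
rewrite ler_wpM2l // ler_wpM2r ?exprn_ge0 ?mulr_ge0 //.
exact: goodD.
Qed.
End Recursion.

(** * Edges in special position *)

Lemma card_bigcup_le (T I : finType) (P : pred I) (F : I -> {set T}) :
  (#|\bigcup_(i | P i) F i| <= \sum_(i | P i) #|F i|)%N.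
Proof.
elim/big_rec2: _ => [|i m B _ IH]; first by rewrite finset.cards0.
by apply: (leq_trans (leq_card_setU _ _)); rewrite leq_add2l.
Qed.

(** Exponents in the count of clashes: a trace of size [w] contributes [D^(k-w)], a set of size
    [k - w + 1] contributes [D^(w-1)], together [D^(k-1)]. Both sizes stay in the range of the
    codegree condition. *)
Lemma complementary_sizes (k w : nat) : (1 < w)%N -> (w <= k.-1)%N ->
  [/\ ((k - w).+1 <= k.-1)%N, (1 < (k - w).+1)%N &
      (k - w + (k - (k - w).+1) = k.-1)%N].
Proof. by move=> w2 wk; split; lia. Qed.

Lemma card_good_arith (R : realType) (d x y c g p K eps : R) :
  (1 - eps) * d <= g -> y <= K * (eps * d) -> c <= p * (eps * d) ->
  g <= x + c + y -> (1 - (1 + K + p) * eps) * d <= x.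
Proof. by move=> h1 h2 h3 h4; lra. Qed.

Section Counting.
Variables (R : realType) (N k : nat) (E : {set {set 'I_N}}) (D eps : R).
Hypotheses (k_ge2 : (2 <= k)%N) (Eunif : uniform E k).
Hypotheses (eps0 : 0 < eps) (eps1 : eps <= 1) (epsD : 1 <= eps * D).
Hypothesis maxcodegD : forall l, (2 <= l)%N -> (l <= k.-1)%N ->
  (maxcodeg E l)%:R <= eps * D ^+ (k - l).
Hypothesis GammaD : (Gamma E k)%:R <= eps * D ^+ k.-1.
Implicit Types (A B C S W e : {set 'I_N}).

Let D_ge1 : 1 <= D.
Proof.
apply: (le_trans epsD); rewrite -[leRHS]mul1r ler_wpM2r //.
have : 0 < eps * D by apply: lt_le_trans epsD.
by rewrite pmulr_rgt0 // => /ltW.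
Qed.

Let D_ge0 : 0 <= D. Proof. exact: le_trans D_ge1. Qed.

Let cardE e : e \in E -> #|e| = k. Proof. exact: card_edge. Qed.

Lemma codeg_max S : (codeg E S <= maxcodeg E #|S|)%N.
Proof. by rewrite /maxcodeg; apply: leq_bigmax_cond. Qed.

Lemma codegD S : (2 <= #|S|)%N -> (#|S| <= k.-1)%N ->
  (codeg E S)%:R <= eps * D ^+ (k - #|S|).
Proof.
by move=> S2 Sk; apply: le_trans (maxcodegD S2 Sk); rewrite ler_nat codeg_max.
Qed.

Lemma card_powersetU1 A (u : 'I_N) K : (#|A| <= K)%N ->
  (#|powerset (u |: A)| <= 2 ^ K.+1)%N.
Proof.
move=> AK; rewrite card_powerset leq_exp2l //.
by apply: (leq_trans (leq_card_setU _ _)); rewrite cards1 add1n.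
Qed.

(** Group the edges by their trace [W] on [u |: A], which contains [u] and a vertex of [A] but is
    not the whole edge. At most [eps D^(k-|W|)] edges share a trace, each of weight [lam^(k-|W|)].
    The base [1 + D * lam] makes one bound serve all sizes. *)
Lemma sum_touching lam A u K : 0 <= lam -> (#|A| <= K)%N ->  u \notin A ->
  \sum_(e in E | [&& u \in e, ~~ [disjoint e & A] & ~~ (e \subset u |: A)])
     lam ^+ #|e :\: (u |: A)| <= (2 ^ K.+1)%:R * (eps * (1 + D * lam) ^+ k).
Proof.
move=> lam0 AK uA; set A' := u |: A.
pose P W := [&& W \in powerset A', 2 <= #|W| & #|W| <= k.-1]%N.
rewrite (partition_big (fun e => e :&: A') P) /=; last first.
  move=> e /andP[eE /and3P[ue eA eA']]; apply/and3P; split.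
  - by rewrite powersetE finset.subsetIr.
  - have [x /andP[xe xA]] : exists x, (x \in e) && (x \in A).
      by move/pred0Pn: eA => [x /= xeA]; exists x.
    have xu : x != u by apply: contraNneq uA => <-.
    rewrite (cardsD1 u) !inE ue eqxx /= (cardsD1 x) !inE xu xe xA orbT //.
  - have k0 : (0 < k)%N by exact: leq_trans k_ge2.
    rewrite -ltnS (ltn_predK k0) -(cardE eE); apply: proper_card.
    rewrite finset.properEneq finset.subsetIl andbT.
    by apply: contraNneq eA' => <-; exact: finset.subsetIr.
have Dl0 : 0 <= D * lam by rewrite mulr_ge0.
apply: (@le_trans _ _ (\sum_(W in powerset A') eps * (1 + D * lam) ^+ k)).
  rewrite big_mkcond [leRHS]big_mkcond /=; apply: ler_sum => W _.
  have bnd0 : 0 <= eps * (1 + D * lam) ^+ k.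
    by rewrite mulr_ge0 ?(ltW eps0) // exprn_ge0 // addr_ge0.
  case: ifP => [/and3P[WA W2 Wk]|_]; last by case: ifP.
  rewrite WA.
  have Wk' : (#|W| <= k)%N by apply: leq_trans Wk (leq_pred _).
  rewrite (eq_bigr (fun=> lam ^+ (k - #|W|))); last first.
    by move=> e /andP[/andP[eE _] /eqP <-]; rewrite cardsD (cardE eE).
  rewrite sumr_const -[leLHS]mulr_natl.
  apply: (@le_trans _ _ (eps * D ^+ (k - #|W|) * lam ^+ (k - #|W|))).
    apply: ler_wpM2r; first exact: exprn_ge0.
    apply: le_trans (codegD W2 Wk); rewrite ler_nat.
    apply: subset_leq_card; apply/fintype.subsetP => e.
    rewrite unfold_in inE => /andP[/andP[eE _] /eqP <-].
    by rewrite eE finset.subsetIl.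
  rewrite -mulrA -exprMn ler_wpM2l ?(ltW eps0) //.
  apply: (@le_trans _ _ ((1 + D * lam) ^+ (k - #|W|))).
    by apply: lerXn2r; rewrite ?nnegrE ?addr_ge0 // lerDr.
  by apply: ler_weXn2l; rewrite ?lerDl // leq_subr.
rewrite sumr_const -[leLHS]mulr_natl ler_wpM2r //.
  by rewrite mulr_ge0 ?(ltW eps0) // exprn_ge0 // addr_ge0.
by rewrite ler_nat card_powersetU1.
Qed.

(* W is the trace on u |: A of an edge e' that prevents e from being good: e' is chosen in
   at most codeg W ways, and then e contains u |: (e' :\: W). If W is a singleton, e is
   controlled by Gamma instead. *)
Definition clash A (u : 'I_N) W : {set {set 'I_N}} := 
  [set e in E | [&& u \in e, [disjoint e & A] &
    [exists e', [&& e' \in E, e' != e, e' \subset A :|: e, 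
       ~~ (e' \subset u |: A) & e' :&: (u |: A) == W]]]]%SET.

Lemma card_clash A u W : u \notin A -> #|clash A u W|%:R <= eps * D ^+ k.-1.
Proof.
move=> uA; set A' := u |: A.
have bnd0 : 0 <= eps * D ^+ k.-1 by rewrite mulr_ge0 ?(ltW eps0) // exprn_ge0.
have k0 : (0 < k)%N by exact: leq_trans k_ge2.
have [->|[e0]] := finset.set_0Vmem (clash A u W); first by rewrite finset.cards0.
rewrite inE => /and4P[e0E ue0 e0A /existsP[g0 /and5P[g0E g0e g0Ae g0A /eqP g0W]]].
have Wlt : (#|W| < k)%N.
  rewrite -(cardE g0E); apply: proper_card; rewrite -g0W.
  rewrite finset.properEneq finset.subsetIl andbT.
  by apply: contraNneq g0A => <-; exact: finset.subsetIr.
have Wk : (#|W| <= k.-1)%N by rewrite -ltnS (ltn_predK k0).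
have WA' : W \subset A' by rewrite -g0W finset.subsetIr.
have outW e e' : e' \subset A :|: e -> e' :&: A' = W -> e' :\: W \subset e :\ u.
  move=> e'Ae e'W; apply/fintype.subsetP => x; rewrite -e'W !inE.
  move=> /andP[xW xe']; move: xW; rewrite xe' /= negb_or => /andP[-> xA] /=.
  by move: (fintype.subsetP e'Ae _ xe'); rewrite inE (negbTE xA).
have Wmem x : x \in W -> x = u \/ x \in A.
  by move/(fintype.subsetP WA'); rewrite !inE => /orP[/eqP->|]; [left|right].
have [W1|W2] := leqP #|W| 1.
  have [a Wa aA] : exists2 a, W = [set a]%SET & a \in A.
    (* If [g0] missed [A], it would lie inside [e0] and equal it by cardinality. Hence the trace is
       not empty, and its single vertex lies in [A]. *)
    have : ~~ [disjoint g0 & A].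
      apply/negP => g0dA; move/negP: g0e; apply; rewrite finset.eqEcard.
      rewrite (cardE g0E) (cardE e0E) leqnn andbT; apply/fintype.subsetP => x xg.
      move: (fintype.subsetP g0Ae _ xg); rewrite inE => /orP[xA|//].
      by move/pred0P: g0dA => /(_ x) /=; rewrite xg xA.
    move=> /pred0Pn [a /= /andP[ag aA]]; exists a => //.
    have aW : a \in W by rewrite -g0W !inE ag aA orbT.
    apply/eqP; rewrite eq_sym finset.eqEcard finset.sub1set aW cards1.
    exact: W1.
  have au : a != u by apply: contraNneq uA => <-.
  apply: le_trans GammaD; rewrite ler_nat.
  pose vv : 'I_N * 'I_N := (a, u).
  pose FF (vv : 'I_N * 'I_N) := #|[set S : {set 'I_N} |
     (#|S| == k.-1) && (vv.1 |: S \in E) && (vv.2 |: S \in E)]%SET|.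
  apply: (@leq_trans (FF vv)); last first.
    apply: leq_trans (@leq_bigmax_cond _ (fun vv => vv.1 != vv.2) FF vv au) _.
    rewrite leq_eqVlt; apply/orP; left; apply/eqP; apply: eq_bigr => vv' _.
    (* the set in the definition of Gamma is a classical set *)
    apply: eq_card => S; rewrite inE; apply/idP/idP.
      by move=> h; rewrite in_setE.
    by rewrite in_setE.
  (* [e :\ u] determines [e] and equals [g :\ a], so it is one of the sets counted by [Gamma] for
     the pair [a], [u]. *)
  rewrite -(@card_in_imset _ _ (fun e => e :\ u) (clash A u W)).
    apply: subset_leq_card; apply/fintype.subsetP => S /imsetP[e].
    rewrite inE => /and4P[eE ue eA /existsP[g /and5P[gE ge gAe gA /eqP gW]]] ->.
    have ceu : #|e :\ u| = k.-1 by rewrite -(cardE eE) (cardsD1 u e) ue.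
    rewrite inE ceu eqxx /= finset.setD1K // eE andbT.
    have ag : a \in g.
      have : a \in W by rewrite Wa finset.set11.
      by rewrite -gW inE => /andP[].
    have -> : e :\ u = g :\ a.
      apply/eqP; rewrite eq_sym finset.eqEcard -{1}Wa outW // ceu.
      by rewrite -(cardE gE) (cardsD1 a g) ag add1n leqnn.
    by rewrite finset.setD1K.
  move=> e1 e2; rewrite !inE.
  move=> /andP[_ /andP[u1 _]] /andP[_ /andP[u2 _]] e12.
  by rewrite -(finset.setD1K u1) -(finset.setD1K u2) e12.
(* The condition on [u] ensures that [u |: (g :\: W)] has exactly [k - #|W| + 1] elements. *)
pose Q := [set g in E | (W \subset g) && (u \notin g :\: W)]%SET.
have sub : clash A u W \subset 
    \bigcup_(g in Q) [set e in E | u |: (g :\: W) \subset e]%SET.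
  apply/fintype.subsetP => e.
  rewrite inE => /and4P[eE ue eA /existsP[g /and5P[gE ge gAe gA /eqP gW]]].
  have gWe := outW _ _ gAe gW.
  apply/bigcupP; exists g.
    rewrite inE gE -{1}gW finset.subsetIl /=.
    by apply/negP => /(fintype.subsetP gWe); rewrite !inE eqxx.
  rewrite inE eE finset.subUset finset.sub1set ue /=.
  by apply: fintype.subset_trans gWe _; exact: finset.subsetDl.
have cg g : g \in Q -> #|u |: (g :\: W)| = (k - #|W|).+1.
  rewrite inE => /and3P[gE Wg ugW].
  by rewrite finset.cardsU1 ugW cardsD (cardE gE) (finset.setIidPr Wg) add1n.
have W0 : (0 < #|W|)%N by exact: ltnW.
apply: (@le_trans _ _ (codeg E W * maxcodeg E (k - #|W|).+1)%:R).
  rewrite ler_nat; apply: leq_trans (subset_leq_card sub) _.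
  apply: leq_trans (card_bigcup_le _ _) _.
  apply: (@leq_trans (\sum_(g in Q) maxcodeg E (k - #|W|).+1)).
    by apply: leq_sum => g gQ; rewrite -(cg _ gQ); exact: codeg_max.
  rewrite sum_nat_const leq_mul2r; apply/orP; right; apply: subset_leq_card.
  by apply/fintype.subsetP => g; rewrite !inE => /and3P[-> ->].
have [e1 e2 e3] := complementary_sizes W2 Wk.
rewrite natrM.
apply: (@le_trans _ _ (eps * D ^+ (k - #|W|) * (eps * D ^+ (k - (k - #|W|).+1)))).
  by apply: ler_pM => //; [exact: codegD | exact: maxcodegD].
rewrite mulrACA -exprD e3.
rewrite ler_wpM2r ?exprn_ge0 //.
by rewrite ler_piMr // ltW.
Qed.

Definition clashes A (u : 'I_N) :=
  [set e in E | [&& u \in e, [disjoint e & A] & ~~ good E A u e]]%SET.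

Lemma card_clashes A u K : (#|A| <= K)%N -> u \notin A ->
  #|clashes A u|%:R <= (2 ^ K.+1)%:R * (eps * D ^+ k.-1).
Proof.
move=> AK uA.
have sub : clashes A u \subset \bigcup_(W in powerset (u |: A)) clash A u W.
  apply/fintype.subsetP => e; rewrite inE => /and4P[eE ue eA].
  rewrite /good eE ue eA /= => /forallPn[g]; rewrite negb_imply.
  move=> /andP[/and3P[gE ge gAe] gA].
  apply/bigcupP; exists (g :&: (u |: A)).
    by rewrite powersetE finset.subsetIr.
  rewrite inE eE ue eA /=; apply/existsP; exists g.
  by rewrite gE ge gAe gA eqxx.
apply: (@le_trans _ _ (\sum_(W in powerset (u |: A)) #|clash A u W|)%:R).
  by rewrite ler_nat (leq_trans (subset_leq_card sub)) // card_bigcup_le.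
rewrite natr_sum.
apply: (@le_trans _ _ (\sum_(W in powerset (u |: A)) (eps * D ^+ k.-1))).
  by apply: ler_sum => W _; exact: card_clash.
rewrite sumr_const -[leLHS]mulr_natl ler_wpM2r ?mulr_ge0 ?(ltW eps0) ?exprn_ge0 //.
by rewrite ler_nat card_powersetU1.
Qed.

(** For [k = 2] pairs are outside the range of the codegree condition; a pair then lies in at most
    one edge, and [1 <= eps * D] gives the bound. *)
Lemma codeg_pair u a : u != a -> (codeg E [set u; a]%SET)%:R <= eps * D ^+ k.-1.
Proof.
move=> ua; have c2 : #|[set u; a]%SET| = 2%N by rewrite cards2 ua.
have [k3|k2] := leqP 3 k.
  apply: le_trans (codegD _ _) _; rewrite ?c2 //.
    by rewrite -subn1 leq_subRL // (leq_trans _ k3).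
  rewrite ler_wpM2l ?(ltW eps0) // ler_weXn2l //.
  by rewrite -subn1 leq_sub2l.
have ke : k = 2%N by apply/eqP; rewrite eqn_leq k_ge2 -ltnS k2.
rewrite ke expr1; apply: le_trans epsD.
rewrite -[leRHS]/(1%:R) ler_nat.
apply: (@leq_trans #|[set [set u; a]%SET]%SET|); last by rewrite cards1.
apply: subset_leq_card; apply/fintype.subsetP => e; rewrite inE => /andP[eE se].
by rewrite inE eq_sym finset.eqEcard se (cardE eE) c2 ke.
Qed.

(** The losses: 1 for the deviation of the degree, [K] for the edges through [u] and a vertex of
    [A], [2 ^ K.+1] for the clashes. *)
Lemma card_good A u K : (#|A| <= K)%N -> u \notin A ->
  (1 - eps) * D ^+ k.-1 <= (codeg E [set u]%SET)%:R ->
  (1 - (1 + K%:R + (2 ^ K.+1)%:R) * eps) * D ^+ k.-1 <=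
    #|[set e in E | good E A u e]%SET|%:R.
Proof.
move=> AK uA degu.
pose X := [set e in E | good E A u e]%SET.
pose Y := \bigcup_(a in A) [set e in E | [set u; a]%SET \subset e]%SET.
have sub : [set e in E | [set u]%SET \subset e]%SET \subset
    (X :|: clashes A u) :|: Y.
  apply/fintype.subsetP => e; rewrite inE finset.sub1set => /andP[eE ue].
  rewrite !inE eE ue /=; case: (boolP (good E A u e)) => //= _.
  rewrite andbT; case: (boolP [disjoint e & A]) => //= /pred0Pn[a /= /andP[ae aA]].
  apply/bigcupP; exists a => //.
  by rewrite inE eE finset.subUset !finset.sub1set ue.
have cle : (codeg E [set u]%SET <= #|X| + #|clashes A u| + #|Y|)%N.
  apply: leq_trans (subset_leq_card sub) _.
  apply: leq_trans (leq_card_setU _ _) _; rewrite leq_add2r.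
  exact: leq_card_setU.
have Yle : #|Y|%:R <= K%:R * (eps * D ^+ k.-1).
  apply: (@le_trans _ _ (\sum_(a in A) codeg E [set u; a]%SET)%:R).
    by rewrite ler_nat card_bigcup_le.
  rewrite natr_sum; apply: (@le_trans _ _ (\sum_(a in A) (eps * D ^+ k.-1))).
    by apply: ler_sum => a aA; apply: codeg_pair; apply: contraNneq uA => ->.
  rewrite sumr_const -[leLHS]mulr_natl ler_wpM2r ?mulr_ge0 ?(ltW eps0) ?exprn_ge0 //.
  by rewrite ler_nat.
have Cle := card_clashes AK uA.
have cleR : (codeg E [set u]%SET)%:R <= #|X|%:R + #|clashes A u|%:R + #|Y|%:R :> R.
  by rewrite -!natrD ler_nat.
exact: card_good_arith degu Yle Cle cleR.
Qed.

(** A bad edge either meets [A] or is a clash; a clash is disjoint from [A], so its weight is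
    [lam ^+ k.-1]. Two equal bounds turn [2 ^ K.+1] into [2 ^ K.+2]. *)
Lemma sum_bad lam A u K : 0 <= lam -> (#|A| <= K)%N -> u \notin A ->
  \sum_(e in E | [&& u \in e, ~~ good E A u e & ~~ (e \subset u |: A)])
     lam ^+ #|e :\: (u |: A)|
  <= (2 ^ K.+2)%:R * (eps * (1 + D * lam) ^+ k).
Proof.
move=> lam0 AK uA.
have Dl0 : 0 <= D * lam by rewrite mulr_ge0.
rewrite (bigID (fun e => ~~ [disjoint e & A])) /=.
rewrite (_ : (2 ^ K.+2)%:R = (2 ^ K.+1)%:R + (2 ^ K.+1)%:R :> R); last first.
  by rewrite -natrD addnn -mul2n -expnS.
rewrite mulrDl; apply: lerD.
  apply: le_trans (sum_touching lam0 AK uA).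
  rewrite big_mkcond [leRHS]big_mkcond /=; apply: ler_sum => e _.
  case: ifP => [/andP[/andP[-> /and3P[-> _ ->]] ->]//|_].
  by case: ifP => _ //; exact: exprn_ge0.
apply: (@le_trans _ _ (\sum_(e in clashes A u) lam ^+ k.-1)).
  rewrite big_mkcond [leRHS]big_mkcond /=; apply: ler_sum => e _.
  case: ifP => [|_]; last by case: ifP => _ //; exact: exprn_ge0.
  rewrite negbK => /andP[/andP[eE /and3P[ue eg _]] eA].
  rewrite inE eE ue eg eA /=.
  have -> : e :\: (u |: A) = e :\ u.
    by rewrite finset.setUC -finset.setDDl; move/finset.setDidPl: eA => ->.
  by rewrite -(cardE eE) (cardsD1 u e) ue.
rewrite sumr_const -[leLHS]mulr_natl.
apply: (@le_trans _ _ ((2 ^ K.+1)%:R * (eps * D ^+ k.-1) * lam ^+ k.-1)).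
  by apply: ler_wpM2r; [exact: exprn_ge0 | exact: card_clashes].
rewrite -!mulrA -exprMn ler_wpM2l // ler_wpM2l ?(ltW eps0) //.
apply: (@le_trans _ _ ((1 + D * lam) ^+ k.-1)).
  by apply: lerXn2r; rewrite ?nnegrE ?addr_ge0 // lerDr.
by apply: ler_weXn2l; rewrite ?lerDl // leq_pred.
Qed.
End Counting.

(** * The fixed point of the recursion *)

Local Open Scope classical_set_scope.

Section FixedPoint.
Variables (R : realType) (m : nat) (s zeta : R).
Hypotheses (m_gt0 : (0 < m)%N) (s_gt0 : 0 < s) (zeta_ge0 : 0 <= zeta).

Definition hmap (t : R) : R := expR (- (zeta * (s * t) ^+ m)).

Lemma hmap_gt0 t : 0 < hmap t. Proof. exact: expR_gt0. Qed.

Lemma hmap_le1 t : 0 <= t -> hmap t <= 1.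
Proof.
move=> t0; rewrite -expR0 ler_expR oppr_le0 mulr_ge0 // exprn_ge0 //.
by rewrite mulr_ge0 // ltW.
Qed.

Lemma hmap_anti t u : 0 <= t -> t <= u -> hmap u <= hmap t.
Proof.
move=> t0 tu; rewrite ler_expR lerN2 ler_wpM2l //.
by rewrite lerXn2r ?nnegrE ?mulr_ge0 ?(le_trans t0 tu) ?ler_wpM2l ?(ltW s_gt0).
Qed.

Lemma continuous_hmap : continuous hmap.
Proof.
move=> t; apply: continuous_comp; last exact: continuous_expR.
apply: continuousN; apply: continuousM; first exact: cvg_cst.
apply: (@continuous_comp _ _ _ (fun t => s * t) (fun u => u ^+ m)); last exact: exprn_continuous.
by apply: continuousM; [exact: cvg_cst | exact: cvg_id].
Qed.

(* The derivative 1/B - C e^(-B) is positive since B e^(-B) <= 1/e < 1/C. *)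
Lemma ln_add_expRN_lt (C B1 B2 : R) : 0 <= C -> C < expR 1 -> 0 < B1 -> B1 < B2 ->
  ln B1 + C * expR (- B1) < ln B2 + C * expR (- B2).
Proof.
move=> C0 Ce B10 B12.
pose f (B : R) := ln B + C * expR (- B).
pose df (B : R) := B^-1 - C * expR (- B).
have dfP (B : R) : 0 < B -> is_derive B 1 f (df B).
  move=> B0; rewrite /f /df.
  have := is_derive1_ln B0 => dln.
  apply: is_deriveD => //.
  have -> : - (C * expR (- B)) = C *: (expR (- B) * -1) by rewrite scalerAl /GRing.scale /=; ring.
  by apply: is_deriveZ.
have [||x xB fx] := @MVT R f df B1 B2 B12.
- move=> x; rewrite in_itv /= => /andP[x1 _]; apply: dfP; exact: lt_trans x1.
- apply: derivable_within_continuous => x; rewrite in_itv /= => /andP[x1 _].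
  by apply: ex_derive; apply: dfP; exact: lt_le_trans x1.
rewrite -/(f B1) -/(f B2) -subr_gt0 fx mulr_gt0 ?subr_gt0 //.
move: xB; rewrite in_itv /= => /andP[Bx _].
have x0 : 0 < x by exact: lt_trans Bx.
rewrite -[ltRHS]div1r ltr_pdivlMr //.
have h : x <= expR (x - 1) by have := expR_ge1Dx (x - 1); rewrite addrC subrK.
rewrite expRN mulrAC ltr_pdivrMr ?expR_gt0 // mul1r.
apply: (@le_lt_trans _ _ (C * expR (x - 1))); first by rewrite ler_wpM2l.
by rewrite expRD expRN mulrCA gtr_pMr ?expR_gt0 // ltr_pdivrMr ?expR_gt0 // mul1r.
Qed.

(** Put [B = C t^m] with [C = m zeta s^m]. After taking logarithms, [b <= h (h b)] reads
    [ln B + C e^(-B) <= ln C] at [t = b]; equality holds at [t = r], and the left side is strictly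
    increasing in [B] for [C < e]. *)
Lemma hmap_two_cycle (r b : R) : m%:R * zeta * s ^+ m < expR 1 ->
  hmap r = r -> b <= hmap (hmap b) -> b <= r.
Proof.
set C := m%:R * zeta * s ^+ m => Ce hr hb.
have m0 : 0 < m%:R :> R by rewrite ltr0n.
have r0 : 0 < r by rewrite -hr hmap_gt0.
have C0 : 0 <= C by rewrite !mulr_ge0 // exprn_ge0 // ltW.
rewrite leNgt; apply/negP => rb.
have b0 : 0 < b by exact: lt_trans rb.
have [z0|zn0] := eqVneq zeta 0.
  have h1 t : hmap t = 1 by rewrite /hmap z0 mul0r oppr0 expR0.
  by move: hb rb; rewrite h1 -hr h1 => /le_lt_trans h /h; rewrite ltxx.
have zp : 0 < zeta by rewrite lt_neqAle eq_sym zn0.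
have Cp : 0 < C by rewrite !mulr_gt0 ?exprn_gt0.
have Cx t : C * t ^+ m = m%:R * (zeta * (s * t) ^+ m) by rewrite exprMn /C; ring.
have eC t : expR (- (C * t ^+ m)) = hmap t ^+ m.
  by rewrite /hmap -expRM_natl Cx mulrN.
have lnh t : m%:R * ln (hmap t) = - (C * t ^+ m) by rewrite /hmap expRK Cx mulrN.
have lnC t : 0 < t -> ln (C * t ^+ m) = ln C + m%:R * ln t.
  by move=> t0; rewrite lnM ?posrE ?exprn_gt0 // lnXn // mulr_natl.
have := @ln_add_expRN_lt C (C * r ^+ m) (C * b ^+ m) C0 Ce.
rewrite !lnC // !eC hr.
have -> : ln C + m%:R * ln r + C * r ^+ m = ln C by rewrite -{1}hr lnh; ring.
have e1 : C * r ^+ m < C * b ^+ m.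
  by rewrite ltr_pM2l // ltrXn2r ?nnegrE ?ltW // -lt0n.
have e2 : 0 < C * r ^+ m by rewrite mulr_gt0 ?exprn_gt0.
move=> /(_ e2 e1).
apply/negP; rewrite -leNgt -addrA gerDl -[C * _]opprK -(lnh (hmap b)) subr_le0.
by rewrite ler_wpM2l ?(ltW m0) // ler_ln ?posrE ?hmap_gt0.
Qed.

(** Instead of iterating, take the infimum [be] of the upper bounds and the supremum [al] of the
    lower ones. By continuity the two implications give [be <= h al] and [h be <= al], so
    [be <= h (h be)] and thus [be <= r]; then [al >= h be >= h r = r]. *)
Lemma two_sided_bounds (U L : R -> Prop) (r : R) :
  m%:R * zeta * s ^+ m < expR 1 -> hmap r = r ->
  U 1 -> L 0 ->
  (forall a b, 0 <= a <= 1 -> L a -> hmap a < b -> U b) ->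
  (forall b a, 0 <= b <= 1 -> U b -> a < hmap b -> L a) ->
  forall d, 0 < d -> (exists2 b, b < r + d & U b) /\ (exists2 a, r - d < a & L a).
Proof.
move=> Ce hr U1 L0 LU UL d d0.
pose SU := [set b : R | 0 <= b <= 1 /\ U b].
pose SL := [set a : R | 0 <= a <= 1 /\ L a].
have SU1 : SU 1 by split => //; rewrite ler01 lexx.
have SL0 : SL 0 by split => //; rewrite ler01 lexx.
have infU : has_inf SU by split; [exists 1 | exists 0 => x [/andP[]]].
have supL : has_sup SL by split; [exists 0 | exists 1 => x [/andP[]]].
set be := inf SU; set al := sup SL.
have beU x : SU x -> be <= x by move=> ?; apply: ge_inf => //; case: infU.
have alL x : SL x -> x <= al by move=> ?; apply: ub_le_sup => //; case: supL.
have be0 : 0 <= be by apply: lb_le_inf; [case: infU | move=> x [/andP[]]].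
have al0 : 0 <= al by exact: alL.
have al1 : al <= 1 by apply: ge_sup; [case: supL | move=> x [/andP[]]].
have be1 : be <= 1 by exact: beU.
have h1 : be <= hmap al.
  rewrite leNgt; apply/negP => lt.
  have : \forall a \near al, hmap a < be by exact: (cvgr_lt (hmap al) (continuous_hmap (x := al))).
  move=> /nbhs_ballP[e /= e0 he].
  have [a [a01 La] ala] := sup_adherent e0 supL.
  have hab : hmap a < be.
    by apply: he; rewrite /ball /= ger0_norm ?subr_ge0 ?alL // ltrBlDr -ltrBlDl.
  pose b := (hmap a + be) / 2.
  have Ub : U b by apply: (LU _ _ a01 La); rewrite /b; lra.
  have : SU b.
    by split => //; have := hmap_gt0 a; rewrite /b => ?; apply/andP; split; lra.
  by move=> /beU; rewrite /b; lra.
have h2 : hmap be <= al.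
  rewrite leNgt; apply/negP => lt.
  have : \forall b \near be, al < hmap b by exact: (cvgr_gt (hmap be) (continuous_hmap (x := be))).
  move=> /nbhs_ballP[e /= e0 he].
  have [b [b01 Ub] beb] := inf_adherent e0 infU.
  have hab : al < hmap b.
    by apply: he; rewrite /ball /= distrC ger0_norm ?subr_ge0 ?beU // ltrBlDr addrC.
  pose a := (hmap b + al) / 2.
  have La : L a by apply: (UL _ _ b01 Ub); rewrite /a; lra.
  have hb1 : hmap b <= 1 by apply: hmap_le1; case/andP: b01.
  have : SL a by split => //; rewrite /a; apply/andP; split; lra.
  by move=> /alL; rewrite /a; lra.
have ber : be <= r.
  apply: hmap_two_cycle => //; apply: (le_trans h1); apply: hmap_anti => //.
  exact/ltW/hmap_gt0.
have ral : r <= al by apply: le_trans h2; rewrite -{1}hr hmap_anti.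
split.
  have [b [_ Ub] beb] := inf_adherent d0 infU.
  by exists b => //; apply: (lt_le_trans beb); rewrite lerD2r.
have [a [_ La] ala] := sup_adherent d0 supL.
by exists a => //; apply: le_lt_trans ala; rewrite lerD2r.
Qed.
End FixedPoint.

Lemma invf_le_mul (R : realType) (s e D : R) : 0 <= s -> 0 < D -> 1 <= e * D ->
  s / D <= s * e.
Proof.
by move=> s0 D0 eD; rewrite ler_wpM2l // -[leLHS]mul1r ler_pdivrMr.
Qed.

Lemma small_perturbation (R : realType) (y C d : R) : 0 <= y -> 0 <= C -> 0 < d ->
  exists e : R, [/\ 0 < e, e <= 1 & C * e * y <= d].
Proof.
move=> y0 C0 d0; have Cy0 : 0 < C * y + 1 by rewrite ltr_wpDl // mulr_ge0.
exists (Num.min 1 (d / (C * y + 1))); split.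
- by rewrite lt_min ltr01 divr_gt0.
- by rewrite ge_min lexx.
have h : Num.min 1 (d / (C * y + 1)) <= d / (C * y + 1) by rewrite ge_min lexx orbT.
have e0 : 0 <= Num.min 1 (d / (C * y + 1)).
  by rewrite le_min ler01 divr_ge0 // ltW.
move: h e0; rewrite ler_pdivlMr //; move: (Num.min _ _) => e h e0.
apply: le_trans h; rewrite mulrDr mulr1 [C * e]mulrC -mulrA lerDl //.
Qed.

(** The function of [e] is the bound of [lower_step] for [lam = s * e] and [theta = C * e]; a strict
    inequality at the limit survives for small [e]. *)
Lemma damped_expR_cvg (R : realType) (z y C s : R) : 
  (fun e : R => expR (- (z * (y + C * e) / (1 - s * e))) / (1 + s * e)) @ 0^'+
    --> expR (- (z * y)).
Proof.
have id0 : (fun e : R => e) @ 0^'+ --> (0 : R) by apply: cvg_at_right_filter; exact: cvg_id.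
have -> : expR (- (z * y)) = expR (- (z * (y + C * 0) * (1 - s * 0)^-1)) * (1 + s * 0)^-1.
  by rewrite !mulr0 subr0 !addr0 invr1 !mulr1.
apply: cvgM; last first.
  apply: cvgV; first by rewrite mulr0 addr0 oner_neq0.
  by apply: cvgD; [exact: cvg_cst | apply: cvgM => //; exact: cvg_cst].
apply: (@cvg_comp _ _ _ (fun e : R => - (z * (y + C * e) / (1 - s * e))) expR); last exact: continuous_expR.
apply: cvgN; apply: cvgM; last first.
  apply: cvgV; first by rewrite mulr0 subr0 oner_neq0.
  by apply: cvgB; [exact: cvg_cst | apply: cvgM => //; exact: cvg_cst].
apply: cvgM; first exact: cvg_cst.
by apply: cvgD; [exact: cvg_cst | apply: cvgM => //; exact: cvg_cst].
Qed.

(* D stands for Delta^(1/(k-1)). *)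
Definition near_treelike (R : realType) (N k : nat) (E : {set {set 'I_N}})
    (D eps : R) : Prop :=
  [/\ 1 <= eps * D,
      forall l, (2 <= l)%N -> (l <= k.-1)%N -> (maxcodeg E l)%:R <= eps * D ^+ (k - l),
      (Gamma E k)%:R <= eps * D ^+ k.-1,
      forall u, (codeg E [set u]%SET)%:R <= D ^+ k.-1
    & forall u, (1 - eps) * D ^+ k.-1 <= (codeg E [set u]%SET)%:R].

(** * Asymptotic occupation ratios *)

Section Asymptotics.
Variables (R : realType) (k : nat) (N : nat -> nat).
Variables (E : forall n, {set {set 'I_(N n)}}) (D : nat -> R).
Hypotheses (k_ge2 : (2 <= k)%N) (Eunif : forall n, uniform (E n) k).
Hypothesis Etree : forall eps : R, 0 < eps ->
  \forall n \near \oo, near_treelike k (E n) (D n) eps.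
Variables (s zeta : R).
Hypotheses (s_gt0 : 0 < s) (zeta01 : 0 <= zeta <= 1).

Let zeta0 : 0 <= zeta. Proof. by case/andP: zeta01. Qed.
Let k1_gt0 : (0 < k.-1)%N. Proof. by rewrite -subn1 subn_gt0. Qed.

(** All [K] are required, each with its own threshold in [n], because a step for [K] consumes the
    opposite bound for [K + k]. *)
Definition ev_upper (b : R) := forall K, \forall n \near \oo,
  upper_ratio (E n) (s / D n) zeta K b.
Definition ev_lower (a : R) := forall K, \forall n \near \oo,
  lower_ratio (E n) (s / D n) zeta K a.

Lemma near_treelike_gt0 n e : 0 < e -> near_treelike k (E n) (D n) e -> 0 < D n.
Proof.
by move=> e0 [h _ _ _ _]; rewrite -(pmulr_rgt0 _ e0); exact: lt_le_trans h.
Qed.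

Lemma ev_upper_step a b : 0 <= a <= 1 -> ev_lower a ->
  hmap k.-1 s zeta a < b -> ev_upper b.
Proof.
move=> /andP[a0 a1] La ab K; rewrite /hmap in ab.
set y := zeta * (s * a) ^+ k.-1 in ab.
have y0 : 0 <= y by rewrite mulr_ge0 // exprn_ge0 // mulr_ge0 // ltW.
pose C : R := 1 + K%:R + (2 ^ K.+1)%:R.
have C0 : 0 <= C by rewrite !addr_ge0.
have b0 : 0 < b by exact: lt_trans (expR_gt0 _) ab.
(* [h(a) < b] means [- y < ln b]; losing a proportion [C * e] of the edges changes the exponent by
   [C * e * y], which has to fit into this gap. *)
have d0 : 0 < ln b + y.
  by rewrite -[y]opprK subr_gt0 -ltr_expR lnK // posrE.
have [e [e0 e1 eC]] := small_perturbation y0 C0 d0.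
apply: filterS2 (Etree e0) (La (K + k)%N) => n tn Ln.
have Dn0 := near_treelike_gt0 e0 tn; case: tn => eD maxD GD degD degD'.
have lam0 : 0 <= s / D n by rewrite divr_ge0 // ltW.
have goodD (A : {set 'I_(N n)}) u : (#|A| <= K)%N -> u \notin A ->
   (1 - C * e) * D n ^+ k.-1 <= #|[set g in E n | good (E n) A u g]%SET|%:R.
  move=> AK uA; exact: (card_good k_ge2 (Eunif n) e0 e1 eD maxD GD AK uA).
have := upper_step lam0 zeta01 k_ge2 (Eunif n) a0 goodD Ln.
move=> U A F u pin AK uA; apply: le_trans (U A F u pin AK uA) _.
apply: ler_wpM2r; first exact: pf_ge0.
rewrite -[leRHS]lnK ?posrE // ler_expR.
have -> : zeta * ((1 - C * e) * D n ^+ k.-1 * (s / D n * a) ^+ k.-1) = (1 - C * e) * y.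
  rewrite -mulrA -exprMn (_ : D n * (s / D n * a) = s * a); last first.
    by rewrite mulrA mulrCA mulfV ?gt_eqF // mulr1.
  by rewrite mulrCA.
by rewrite mulrBl mul1r opprB lerBlDr.
Qed.

Lemma ev_lower_step b a : 0 <= b <= 1 -> ev_upper b ->
  a < hmap k.-1 s zeta b -> ev_lower a.
Proof.
move=> b01 Ub ab K; rewrite /hmap in ab.
pose C : R := (2 ^ K.+2)%:R * (1 + s) ^+ k.
have C0 : 0 <= C by rewrite mulr_ge0 // exprn_ge0 // addr_ge0 // ltW.
have /andP[b0 b1] := b01.
set y := (s * b) ^+ k.-1 in ab.
have y0 : 0 <= y by rewrite exprn_ge0 // mulr_ge0 // ltW.
have ev := cvgr_gt _ (@damped_expR_cvg R zeta y C s) _ ab.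
have ne : \forall e \near (0 : R)^'+, [/\ 0 < e, e <= 1, s * e < 1 &
    a <= expR (- (zeta * (y + C * e) / (1 - s * e))) / (1 + s * e)].
  near=> e; split.
  - by near: e; exact: nbhs_right_gt.
  - by near: e; exact: nbhs_right_le.
  - rewrite mulrC -ltr_pdivlMr //; near: e; apply: nbhs_right_lt.
    by rewrite divr_gt0.
  - apply: ltW; near: e.
    exact: ev.
have [e [e0 e1 se1 ae]] := filter_ex ne.
apply: filterS2 (Etree e0) (Ub (K + k)%N) => n tn Un.
have Dn0 := near_treelike_gt0 e0 tn; case: tn => eD maxD GD degD degD'.
have lam0 : 0 <= s / D n by rewrite divr_ge0 // ltW.
have lame : s / D n <= s * e by apply: invf_le_mul => //; exact: ltW.
have lam1 : s / D n < 1 by exact: le_lt_trans se1.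
have badD (A : {set 'I_(N n)}) u : (#|A| <= K)%N -> u \notin A ->
  \sum_(g in E n | [&& u \in g, ~~ good (E n) A u g & ~~ (g \subset u |: A)])
        (s / D n) ^+ #|g :\: (u |: A)| <= C * e.
  move=> AK uA.
  apply: le_trans (sum_bad k_ge2 (Eunif n) e0 e1 eD maxD GD lam0 AK uA) _.
  rewrite (_ : D n * (s / D n) = s); last by rewrite mulrCA mulfV ?gt_eqF // mulr1.
  by rewrite /C mulrCA mulrC.
have L := lower_step lam0 zeta01 k_ge2 (Eunif n) b01 lam1 degD badD Un.
move=> A F u pin AK uA nF; apply: le_trans (L A F u pin AK uA nF).
apply: ler_wpM2r; first exact: pf_ge0.
apply: (le_trans ae); apply: ler_pM; rewrite ?expR_ge0 ?invr_ge0 //.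
- by rewrite addr_ge0 // mulr_ge0 // ltW.
- rewrite ler_expR lerN2 -exprMn (_ : D n * (s / D n * b) = s * b); last first.
    by rewrite mulrA mulrCA mulfV ?gt_eqF // mulr1.
  rewrite ler_wpM2l //.
    by rewrite mulr_ge0 // addr_ge0 // mulr_ge0 // ltW.
  by rewrite lef_pV2 ?posrE ?subr_gt0 // lerD2l lerN2.
- rewrite lef_pV2 ?posrE ?ltr_wpDr // ?mulr_ge0 ?(ltW s_gt0) ?(ltW e0) //.
  by rewrite lerD2l.
Unshelve. all: by end_near. Qed.

(** Multiplied by [s / D n], the ratio is the probability that [u] is occupied. Uniformity in [u]
    lets the bounds pass to the average over all vertices. *)
Lemma occupation_ratio (r d : R) : k.-1%:R * zeta * s ^+ k.-1 < expR 1 ->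
  hmap k.-1 s zeta r = r -> 0 < d ->
  \forall n \near \oo, forall u,
    (r - d) * pf (s / D n) zeta finset.set0 (E n)
      <= pf (s / D n) zeta [set u]%SET (E n)
      <= (r + d) * pf (s / D n) zeta finset.set0 (E n).
Proof.
move=> Ce hr d0.
have lamge : \forall n \near \oo, 0 <= s / D n.
  apply: filterS (Etree ltr01) => n /(near_treelike_gt0 ltr01) Dn0.
  by rewrite divr_ge0 // ltW.
have U1 : ev_upper 1.
  by move=> K; apply: filterS lamge => n lam0; exact: upper_ratio1.
have L0 : ev_lower 0.
  by move=> K; apply: filterS lamge => n lam0; exact: lower_ratio0.
have [[b bd Ub] [a ad La]] := two_sided_bounds k1_gt0 s_gt0 zeta0 Ce hr U1 L0
  ev_upper_step ev_lower_step d0.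
apply: filterS3 lamge (Ub 0%N) (La 0%N) => n lam0 Un Ln u.
have pin : pinned (E n) finset.set0 (E n).
  split => // e eE; rewrite finset.subset0 -finset.cards_eq0 (card_edge (Eunif n) eE).
  by rewrite -lt0n; apply: leq_trans k_ge2.
have uF e : e \in E n -> ~~ (e \subset [set u]%SET).
  move=> eE; apply/negP => /subset_leq_card.
  by rewrite (card_edge (Eunif n) eE) cards1 leqNgt k_ge2.
have p0 : 0 <= pf (s / D n) zeta finset.set0 (E n) by exact: pf_ge0.
have c0 : (#|@finset.set0 'I_(N n)| <= 0)%N by rewrite finset.cards0.
have nu : u \notin finset.set0 by rewrite inE.
have := Un _ _ _ pin c0 nu; have := Ln _ _ _ pin c0 nu.
rewrite finset.setU0 => /(_ uF) h1 h2; apply/andP; split.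
- by apply: le_trans h1; rewrite ler_wpM2r // ltW.
- by apply: (le_trans h2); rewrite ler_wpM2r // ltW.
Qed.
End Asymptotics.

(** * Free energy *)

Section FreeEnergyCurve.
Variables (R : realType) (k : nat).
Hypothesis k_ge2 : (2 <= k)%N.

(** The density [x] is the coordinate and [s = activity zeta x] is computed from it; the fixed point
    is then [x / s], with no inverse function to handle. *)
Definition activity (zeta x : R) : R := x * expR (zeta * x ^+ k.-1).
Definition free_energy (zeta x : R) : R := x + x ^+ k * (1 - k%:R^-1) * zeta.

Lemma weighted_amgm (x y : R) (m : nat) : 0 <= x -> 0 <= y ->
  m.+1%:R * (x * y ^+ m) <= m%:R * y ^+ m.+1 + x ^+ m.+1.
Proof.
move=> x0 y0; elim: m => [|m IH]; first by rewrite mul0r add0r expr0 mulr1 mul1r expr1.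
have h : x * y ^+ m.+1 + x ^+ m.+1 * y <= y ^+ m.+2 + x ^+ m.+2.
  rewrite -subr_ge0.
  have -> : y ^+ m.+2 + x ^+ m.+2 - (x * y ^+ m.+1 + x ^+ m.+1 * y) =
     (x ^+ m.+1 - y ^+ m.+1) * (x - y).
    by rewrite (exprS y m.+1) (exprS x m.+1); ring.
  have [xy|yx] := leP x y.
    by rewrite mulr_le0 // ?subr_le0 // lerXn2r.
  by rewrite mulr_ge0 // ?subr_ge0 ?(ltW yx) // lerXn2r // ?ltW.
have -> : m.+2%:R * (x * y ^+ m.+1) = m.+1%:R * (x * y ^+ m) * y + x * y ^+ m.+1.
  by rewrite -(natr1 m.+1) (exprSr y m); ring.
have -> : m.+1%:R * y ^+ m.+2 = m%:R * y ^+ m.+1 * y + y ^+ m.+2.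
  by rewrite -(natr1 m) (exprSr y m.+1); ring.
have := ler_wpM2r y0 IH; rewrite mulrDl => h2.
move: h h2.
move: (x * y ^+ m.+1) (y ^+ m.+2) (x ^+ m.+2) (x ^+ m.+1 * y) => b c d e.
move: (_ * y) (_ * y) => f g h h2; lra.
Qed.

Lemma ln_sub_le (x y : R) : 0 < x -> 0 < y -> y * (ln x - ln y) <= x - y.
Proof.
move=> x0 y0; rewrite -ln_div ?posrE //.
have := le_ln1Dx (x := x / y - 1); rewrite (addrC 1) subrK => h.
have xy : 0 < x / y by rewrite divr_gt0.
have : ln (x / y) <= x / y - 1 by apply: h; lra.
move=> /(ler_wpM2l (ltW y0)); rewrite mulrBr mulr1 mulrCA mulfV ?gt_eqF //.
by rewrite mulr1.
Qed.

Let k_gt0 : (0 < k)%N. Proof. exact: leq_trans k_ge2. Qed.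

Lemma activity_gt0 zeta x : 0 < x -> 0 < activity zeta x.
Proof. by move=> x0; rewrite mulr_gt0 // expR_gt0. Qed.

Lemma ln_activity zeta x : 0 < x -> ln (activity zeta x) = ln x + zeta * x ^+ k.-1.
Proof. by move=> x0; rewrite lnM ?posrE ?expR_gt0 // expRK. Qed.

Lemma activity_lt zeta x y : 0 <= zeta -> 0 < x -> x < y ->
  activity zeta x < activity zeta y.
Proof.
move=> z0 x0 xy; have y0 : 0 < y by exact: lt_trans xy.
apply: (@lt_le_trans _ _ (y * expR (zeta * x ^+ k.-1))).
  by rewrite ltr_pM2r // expR_gt0.
rewrite ler_wpM2l ?(ltW y0) // ler_expR ler_wpM2l //.
by rewrite lerXn2r ?nnegrE ?(ltW x0) ?(ltW y0) // ltW.
Qed.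

Lemma activity_le zeta x y : 0 <= zeta -> 0 < x -> x <= y ->
  activity zeta x <= activity zeta y.
Proof.
move=> z0 x0; rewrite le_eqVlt => /orP[/eqP->//|xy].
by apply: ltW; exact: activity_lt.
Qed.

(** Convexity of the free energy as a function of [ln s], with slope [y] at density [y]. The
    logarithmic part is [ln_sub_le], the power part is weighted AM-GM. *)
Lemma free_energy_increment zeta x y : 0 <= zeta -> 0 < x -> 0 < y ->
  free_energy zeta y - free_energy zeta x <=
    y * (ln (activity zeta y) - ln (activity zeta x)).
Proof.
move=> z0 x0 y0; rewrite !ln_activity //.
have h1 := ln_sub_le x0 y0.
have kE : k = k.-1.+1 by rewrite prednK.
have := weighted_amgm k.-1 (ltW y0) (ltW x0).
rewrite -kE.
have kk : k%:R = k.-1%:R + 1 :> R by rewrite {1}kE natr1.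
have kp : 0 < k%:R :> R by rewrite ltr0n.
move=> h2.
have h3 : (y ^+ k - x ^+ k) * (1 - k%:R^-1) <= y * (y ^+ k.-1 - x ^+ k.-1).
  rewrite [leRHS]mulrBr (_ : y * y ^+ k.-1 = y ^+ k); last by rewrite -exprS -kE.
  rewrite -(ler_pM2l kp).
  have -> : k%:R * ((y ^+ k - x ^+ k) * (1 - k%:R^-1)) = (y ^+ k - x ^+ k) * (k%:R - 1).
    by rewrite mulrCA mulrBr mulr1 mulfV ?gt_eqF.
  move: h2; rewrite kk; move: (k.-1%:R : R) (x ^+ k) (y ^+ k) (y * _) => a b c d; clear.
  by move=> h2; nra.
have h4 := ler_wpM2l z0 h3.
rewrite /free_energy; move: h1 h4.
move: (ln x) (ln y) (x ^+ k) (y ^+ k) (x ^+ k.-1) (y ^+ k.-1) (1 - k%:R^-1).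
move=> a b c d e f g; clear; nra.
Qed.

Lemma free_energy_ge0 zeta x : 0 <= zeta -> 0 < x -> 0 <= free_energy zeta x.
Proof.
move=> z0 x0; rewrite addr_ge0 ?(ltW x0) // !mulr_ge0 ?exprn_ge0 ?(ltW x0) //.
by rewrite subr_ge0 invf_le1 ?ltr0n // ler1n.
Qed.

Lemma free_energy_le_activity zeta x : 0 <= zeta -> 0 < x ->
  free_energy zeta x <= activity zeta x.
Proof.
move=> z0 x0; apply: (@le_trans _ _ (x * (1 + zeta * x ^+ k.-1))); last first.
  by rewrite ler_wpM2l ?(ltW x0) // expR_ge1Dx.
rewrite mulrDr mulr1 lerD2l mulrCA -exprS prednK // [leRHS]mulrC ler_wpM2r //.
by rewrite ler_piMr ?exprn_ge0 ?(ltW x0) // gerBl invr_ge0.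
Qed.

Lemma continuous_free_energy zeta : continuous (free_energy zeta).
Proof.
rewrite /free_energy => x; apply: cvgD; first exact: cvg_id.
apply: cvgM; last exact: cvg_cst.
by apply: cvgM; [exact: exprn_continuous | exact: cvg_cst].
Qed.

Lemma continuous_activity zeta : continuous (activity zeta).
Proof.
rewrite /activity => x; apply: cvgM; first exact: cvg_id.
apply: continuous_comp; last exact: continuous_expR.
by apply: continuousM; [exact: cvg_cst | exact: exprn_continuous].
Qed.
End FreeEnergyCurve.

(** * Bounds for a single partition function *)

Section OneHypergraph.
Variables (R : realType) (N k : nat) (E : {set {set 'I_N}}).
Hypotheses (k_gt0 : (0 < k)%N) (Eunif : uniform E k).
Implicit Types (S : {set 'I_N}) (lam zeta : R).

Definition Zpart lam zeta : R :=
  \sum_(S : {set 'I_N}) lam ^+ #|S| * (1 - zeta) ^+ Xcount E S.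

Lemma Zpart_pf lam zeta : pf lam zeta finset.set0 E = Zpart lam zeta.
Proof.
apply: eq_big => S; first by rewrite disjoint_sym finset.disjoints_subset finset.sub0set.
by rewrite finset.setU0.
Qed.

Lemma sum_sizes lam zeta :
  \sum_(S : {set 'I_N}) #|S|%:R * (lam ^+ #|S| * (1 - zeta) ^+ Xcount E S) =
  lam * \sum_(u : 'I_N) pf lam zeta [set u]%SET E.
Proof.
transitivity (\sum_(S : {set 'I_N}) \sum_(u | u \in S)
    (lam ^+ #|S| * (1 - zeta) ^+ Xcount E S)).
  by apply: eq_bigr => S _; rewrite sumr_const mulr_natl.
rewrite (exchange_big_dep xpredT) //= mulr_sumr; apply: eq_bigr => u _.
have d0 (S : {set 'I_N}) : [disjoint S & finset.set0]%B.
  by rewrite disjoint_sym finset.disjoints_subset finset.sub0set.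
rewrite (eq_bigl (fun S : {set 'I_N} => [disjoint S & finset.set0]%B && ([set u]%SET \subset S))).
  rewrite sum_supersets // finset.set0U /pf mulr_sumr; apply: eq_bigr => S.
  rewrite disjoint_sym finset.disjoints1 => uS.
  by rewrite finset.cardsU1 uS add1n exprS -mulrA finset.setUC.
by move=> S; rewrite d0 finset.sub1set.
Qed.

Lemma Xcount0 : Xcount E finset.set0 = 0%N.
Proof.
apply/eqP; rewrite cards_eq0; apply/eqP/setP => e; rewrite !inE.
apply/negP => /andP[eE]; rewrite finset.subset0 => /eqP e0.
by have := card_edge Eunif eE; rewrite e0 finset.cards0 => k0; move: k_gt0; rewrite -k0.
Qed.

Lemma Zpart_ge1 lam zeta : 0 <= lam -> 0 <= zeta <= 1 -> 1 <= Zpart lam zeta.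
Proof.
move=> lam0 /andP[z0 z1]; rewrite /Zpart (bigD1 finset.set0) //=.
rewrite finset.cards0 expr0 mul1r Xcount0.
rewrite expr0 lerDl sumr_ge0 // => S _.
by rewrite mulr_ge0 // exprn_ge0 // subr_ge0.
Qed.

Lemma sum_exp_card lam : \sum_(S : {set 'I_N}) lam ^+ #|S| = (1 + lam) ^+ N.
Proof.
have := @bigA_distr R 0 1 *%R +%R 'I_N (fun=> lam) (fun=> 1).
rewrite prodr_const card_ord addrC => ->; apply: eq_bigr => S _.
by rewrite -big_mkcond prodr_const.
Qed.

Lemma ln_Zpart_le lam zeta : 0 <= lam -> 0 <= zeta <= 1 ->
  ln (Zpart lam zeta) <= N%:R * lam.
Proof.
move=> lam0 z01; have Z1 := Zpart_ge1 lam0 z01; have /andP[z0 z1] := z01.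
have Z0 : 0 < Zpart lam zeta by exact: lt_le_trans Z1.
have l1 : 0 < 1 + lam by rewrite ltr_wpDr.
apply: (@le_trans _ _ (ln ((1 + lam) ^+ N))).
  rewrite ler_ln ?posrE ?exprn_gt0 // -sum_exp_card; apply: ler_sum => S _.
  rewrite ler_piMr ?exprn_ge0 // exprn_ile1 //; first by rewrite subr_ge0.
  by rewrite gerBl.
rewrite lnXn // mulr_natl; apply: ler_wMn2r.
by rewrite le_ln1Dx // (lt_le_trans _ lam0) // ltrN10.
Qed.

Lemma Zpart_mono lam lam' zeta : 0 <= lam -> lam <= lam' -> 0 <= zeta <= 1 ->
  Zpart lam zeta <= Zpart lam' zeta.
Proof.
move=> l0 ll /andP[z0 z1]; apply: ler_sum => S _.
rewrite ler_wpM2r ?exprn_ge0 ?subr_ge0 // lerXn2r // nnegrE //.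
exact: le_trans ll.
Qed.

(* Jensen's inequality for q^|S| under the Gibbs measure. *)
Lemma ln_Zpart_scale lam zeta q : 0 <= lam -> 0 <= zeta <= 1 -> 0 < q ->
  ln (Zpart lam zeta) + ln q *
     ((lam * \sum_(u : 'I_N) pf lam zeta [set u]%SET E) / Zpart lam zeta) <=
  ln (Zpart (q * lam) zeta).
Proof.
move=> lam0 z01 q0; have Z1 := Zpart_ge1 lam0 z01; have /andP[z0 z1] := z01.
have Z0 : 0 < Zpart lam zeta by exact: lt_le_trans Z1.
have Zq0 : 0 < Zpart (q * lam) zeta.
  by apply: lt_le_trans (Zpart_ge1 _ z01) => //; rewrite mulr_ge0 // ltW.
rewrite -sum_sizes.
set w := fun S => lam ^+ #|S| * (1 - zeta) ^+ Xcount E S.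
set M := _ / _.
have w0 S : 0 <= w S by rewrite mulr_ge0 // exprn_ge0 // subr_ge0.
rewrite -ler_expR expRD !lnK ?posrE //.
have -> : Zpart lam zeta * expR (ln q * M) = \sum_(S : {set 'I_N})
     w S * (expR (ln q * M) * (1 + (#|S|%:R - M) * ln q)).
  transitivity (expR (ln q * M) * (\sum_(S : {set 'I_N}) w S + ln q *
     (\sum_(S : {set 'I_N}) #|S|%:R * w S - M * \sum_(S : {set 'I_N}) w S))).
    rewrite -/(Zpart lam zeta) /M -/(Zpart lam zeta).
    by rewrite divfK ?gt_eqF // subrr mulr0 addr0 mulrC.
  rewrite mulr_sumr -sumrB mulr_sumr -big_split mulr_sumr /=.
  by apply: eq_bigr => S _; ring.
apply: ler_sum => S _.
have -> : (q * lam) ^+ #|S| * (1 - zeta) ^+ Xcount E S = w S * q ^+ #|S|.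
  by rewrite exprMn -mulrA mulrC.
rewrite ler_wpM2l //.
rewrite -[X in X ^+ _]lnK ?posrE // -expRM_natl.
have -> : #|S|%:R * ln q = ln q * M + (#|S|%:R - M) * ln q by ring.
by rewrite expRD ler_wpM2l ?expR_ge0 // expR_ge1Dx.
Qed.
End OneHypergraph.

(** * Convergence to the free energy *)

Section FreeEnergyLimit.
Variables (R : realType) (k : nat) (N : nat -> nat).
Variables (E : forall n, {set {set 'I_(N n)}}) (D : nat -> R).
Hypotheses (k_ge2 : (2 <= k)%N) (Eunif : forall n, uniform (E n) k).
Hypothesis Etree : forall eps : R, 0 < eps ->
  \forall n \near \oo, near_treelike k (E n) (D n) eps.
Hypothesis Npos : \forall n \near \oo, (0 < N n)%N.
Variable zeta : R.
Hypothesis zeta01 : 0 <= zeta <= 1.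

Let zeta0 : 0 <= zeta. Proof. by case/andP: zeta01. Qed.
Let k_gt0 : (0 < k)%N. Proof. exact: leq_trans k_ge2. Qed.

Definition scaled_lnZ (n : nat) (lam : R) : R :=
  D n / (N n)%:R * ln (Zpart (E n) lam zeta).

Local Notation act := (activity k zeta).
Local Notation Phi := (free_energy k zeta).

Definition uniqueness (x : R) : Prop := k.-1%:R * zeta * act x ^+ k.-1 < expR 1.

Lemma Dpos : \forall n \near \oo, 0 < D n.
Proof. by apply: filterS (Etree ltr01) => n /(near_treelike_gt0 ltr01). Qed.

Lemma hmap_activity x : 0 < x -> hmap k.-1 (act x) zeta (x / act x) = x / act x.
Proof.
move=> x0; have a0 := activity_gt0 k zeta x0.
rewrite /hmap mulrCA mulfV ?gt_eqF // mulr1 /activity expRN invfM mulrA.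
by rewrite mulfV ?gt_eqF // mul1r.
Qed.

(** Since [y] may lie on either side of [x], exchanging the two points yields the matching upper
    bound on the increment. *)
Lemma scaled_lnZ_step x y d : 0 < x -> 0 < y -> uniqueness x -> 0 < d ->
  \forall n \near \oo, scaled_lnZ n (act x / D n)
     + (ln (act y) - ln (act x)) * x - d <= scaled_lnZ n (act y / D n).
Proof.
move=> x0 y0 ux d0; have ax0 := activity_gt0 k zeta x0; have ay0 := activity_gt0 k zeta y0.
set L := ln (act y) - ln (act x).
pose q := act y / act x.
have q0 : 0 < q by rewrite divr_gt0.
have lnq : ln q = L by rewrite ln_div ?posrE.
pose e := d / (`|L| * act x + 1).
have LA0 : 0 < `|L| * act x + 1 by rewrite ltr_wpDl // mulr_ge0 // ltW.
have e0 : 0 < e by rewrite divr_gt0.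
have := occupation_ratio k_ge2 Eunif Etree ax0 zeta01 ux (hmap_activity x0) e0.
apply: filterS3 Npos Dpos => n Nn Dn occ.
have lam0 : 0 <= act x / D n by rewrite divr_ge0 // ltW.
have Z1 := Zpart_ge1 k_gt0 (Eunif n) lam0 zeta01.
have Z0 : 0 < Zpart (E n) (act x / D n) zeta by exact: lt_le_trans Z1.
have := ln_Zpart_scale k_gt0 (Eunif n) lam0 zeta01 q0.
have -> : q * (act x / D n) = act y / D n by rewrite /q mulrA divfK ?gt_eqF.
set Z := Zpart _ _ _ in Z0 occ *; set Z' := Zpart _ _ _.
set sm := \sum_(u : _) _.
have N0 : 0 < (N n)%:R :> R by rewrite ltr0n.
rewrite lnq /scaled_lnZ -/Z -/Z' => hZ.
have c0 : 0 <= D n / (N n)%:R by rewrite divr_ge0 // ltW.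
apply: le_trans (ler_wpM2l c0 hZ); rewrite mulrDr -addrA lerD2l.
have -> : D n / (N n)%:R * (L * (act x / D n * sm / Z)) =
   L * (act x * (sm / ((N n)%:R * Z))).
  by field; rewrite !gt_eqF.
set av := sm / _.
have smE (t : R) : \sum_(u : 'I_(N n)) t * Z = t * ((N n)%:R * Z).
  by rewrite sumr_const card_ord mulrCA mulr_natl.
have NZ0 : 0 < (N n)%:R * Z by rewrite mulr_gt0.
have av1 : x / act x - e <= av.
  rewrite ler_pdivlMr // -smE; apply: ler_sum => u _.
  by have /andP[] := occ u; rewrite Zpart_pf.
have av2 : av <= x / act x + e.
  rewrite ler_pdivrMr // -smE; apply: ler_sum => u _.
  by have /andP[] := occ u; rewrite Zpart_pf.
have av3 : `|act x * av - x| <= act x * e.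
  have -> : act x * av - x = act x * (av - x / act x).
    by rewrite mulrBr [act x * (x / _)]mulrC divfK ?gt_eqF.
  by rewrite normrM gtr0_norm // ler_pM2l // ler_distl av1 av2.
have : `|L * (act x * av - x)| <= d.
  rewrite normrM; apply: le_trans (ler_wpM2l (normr_ge0 L) av3) _.
  rewrite mulrA /e mulrA ler_pdivrMr // [leRHS]mulrC ler_pM2r //.
  by rewrite lerDl.
rewrite mulrBr ler_distl => /andP[h _].
by rewrite lerBlDr; move: h; rewrite lerBlDr.
Qed.

(** Over a cell from [y] to [y + h], the increments of [scaled_lnZ] and of [Phi] both lie, up to
    small errors, between [y] and [y + h] times the increment of [ln act]. They differ by about [h]
    times that increment, and the increments telescope. *)
Lemma scaled_lnZ_grid x0 h M : 0 < x0 -> 0 < h ->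
  (forall i, (i <= M)%N -> uniqueness (x0 + i%:R * h)) ->
  forall i, (i <= M)%N -> let x := x0 + i%:R * h in
  forall d, 0 < d -> \forall n \near \oo,
    `|scaled_lnZ n (act x / D n) - scaled_lnZ n (act x0 / D n) - (Phi x - Phi x0)|
      <= h * (ln (act x) - ln (act x0)) + d.
Proof.
move=> x00 h0 uq; elim => [|i IH] iM x d d0.
  apply: nearW => n; rewrite /x mul0r addr0 !subrr normr0 mulr0 add0r ltW //.
pose y := x0 + i%:R * h.
have y0 : 0 < y by rewrite ltr_wpDr // mulr_ge0 // ltW.
have xy : x = y + h by rewrite /x /y -natr1 mulrDl mul1r addrA.
have x0' : 0 < x by rewrite xy addr_gt0.
have uy : uniqueness y by apply: uq; exact: ltnW.
have ux : uniqueness x by exact: uq.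
have d2 : 0 < d / 2 by rewrite divr_gt0.
have L0 : ln (act y) <= ln (act x).
  by rewrite ler_ln ?posrE ?activity_gt0 // activity_le // xy lerDl ltW.
have P1 := free_energy_increment k_ge2 zeta0 x0' y0.
have P2 := free_energy_increment k_ge2 zeta0 y0 x0'.
have := IH (ltnW iM) _ d2; rewrite -/y => IHy.
apply: filterS3 IHy (scaled_lnZ_step x0' y0 ux d2) (scaled_lnZ_step y0 x0' uy d2) => n.
rewrite !ler_norml; move: (scaled_lnZ n _) (scaled_lnZ n _) (scaled_lnZ n _).
move: (ln (act y)) (ln (act x)) (ln (act x0)) (Phi x) (Phi y) (Phi x0) L0 P1 P2.
rewrite xy; clear - h0; move=> a b c P Q S ab h1 h2 u v w /andP[h3 h4] h5 h6.
by apply/andP; split; nra.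
Qed.

Lemma scaled_lnZ_le x : 0 < x -> \forall n \near \oo,
  0 <= scaled_lnZ n (act x / D n) <= act x.
Proof.
move=> x0; apply: filterS2 Npos Dpos => n Nn Dn.
have N0 : 0 < (N n)%:R :> R by rewrite ltr0n.
have lam0 : 0 <= act x / D n by rewrite divr_ge0 ?(ltW Dn) // ltW // activity_gt0.
have Z1 := Zpart_ge1 k_gt0 (Eunif n) lam0 zeta01.
apply/andP; split.
  by rewrite mulr_ge0 ?ln_ge0 // divr_ge0 // ltW.
have c0 : 0 <= D n / (N n)%:R by rewrite divr_ge0 // ltW.
apply: le_trans (ler_wpM2l c0 (ln_Zpart_le k_gt0 (Eunif n) lam0 zeta01)) _.
by rewrite le_eqVlt; apply/orP; left; apply/eqP; field; rewrite !gt_eqF.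
Qed.

Lemma uniqueness_le x y : 0 < x -> x <= y -> uniqueness y -> uniqueness x.
Proof.
move=> x0 xy; apply: le_lt_trans; rewrite ler_wpM2l //; first by rewrite mulr_ge0.
have y0 : 0 < y by exact: lt_le_trans xy.
by rewrite lerXn2r ?nnegrE ?(ltW (activity_gt0 _ _ _)) // activity_le.
Qed.

(** As [ln act] diverges at density 0, the grid starts at a small [z > 0], where both quantities lie
    between 0 and [act z <= d / 8]; the mesh is then chosen so that the accumulated cell error is at
    most [d / 4]. *)
Lemma scaled_lnZ_approx x d : 0 < x -> uniqueness x -> 0 < d ->
  \forall n \near \oo, `|scaled_lnZ n (act x / D n) - Phi x| <= d.
Proof.
move=> x0 ux d0.
pose g := d / 8 / expR (zeta * x ^+ k.-1).
have g0 : 0 < g by rewrite !divr_gt0 ?expR_gt0.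
pose z := Num.min (x / 2) g.
have z0 : 0 < z by rewrite lt_min g0 divr_gt0.
have zx : z < x.
  by apply: (@le_lt_trans _ _ (x / 2)); [rewrite ge_min lexx | lra].
have az : act z <= d / 8.
  apply: (@le_trans _ _ (z * expR (zeta * x ^+ k.-1))).
    rewrite ler_wpM2l ?(ltW z0) // ler_expR ler_wpM2l //.
    by rewrite lerXn2r ?nnegrE ?(ltW z0) ?(ltW x0) // ltW.
  by rewrite -ler_pdivlMr ?expR_gt0 // ge_min lexx orbT.
pose L := ln (act x) - ln (act z).
have L0 : 0 <= L by rewrite subr_ge0 ler_ln ?posrE ?activity_gt0 // activity_le // ltW.
have [M hM] : exists M : nat, (x - z) * L / (d / 4) < M.+1%:R.
  have B0 : 0 <= (x - z) * L / (d / 4).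
    apply: divr_ge0; last by rewrite divr_ge0 // ltW.
    by apply: mulr_ge0 L0; rewrite subr_ge0 ltW.
  exists (Num.truncn ((x - z) * L / (d / 4))).
  by have /andP[] := truncn_itv B0.
pose h := (x - z) / M.+1%:R.
have h0 : 0 < h by rewrite divr_gt0 ?ltr0n // subr_gt0.
have hx : z + M.+1%:R * h = x.
  by rewrite /h mulrCA mulfV ?gt_eqF ?ltr0n // mulr1 addrC subrK.
have uq i : (i <= M.+1)%N -> uniqueness (z + i%:R * h).
  move=> iM; apply: uniqueness_le ux.
    by rewrite ltr_wpDr // mulr_ge0 // ltW.
  by rewrite -hx lerD2l ler_wpM2r ?(ltW h0) // ler_nat.
have d4 : 0 < d / 4 by rewrite divr_gt0.
have := scaled_lnZ_grid z0 h0 uq (leqnn _) d4; rewrite hx -/L => G.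
have hL : h * L <= d / 4.
  rewrite /h mulrAC ler_pdivrMr ?ltr0n //.
  by move: hM; rewrite ltr_pdivrMr // [ltRHS]mulrC => /ltW.
have F1 := free_energy_le_activity k_ge2 zeta0 z0.
have F0 := free_energy_ge0 k_ge2 zeta0 z0.
apply: filterS2 G (scaled_lnZ_le z0) => n.
rewrite !ler_norml; move: (scaled_lnZ n _) (scaled_lnZ n _) => u v.
move: hL F1 F0 az; move: (h * L) (Phi z) (Phi x) (act z) => a b c e.
clear - d0; move=> h1 h2 h3 h4 /andP[h5 h6] /andP[h7 h8].
by apply/andP; split; lra.
Qed.

(** Monotonicity of [Zpart] in [lam] sandwiches the value between those at densities [x - e / 2] and
    [x + e / 2]. *)
Lemma scaled_lnZ_cvg x (lam : nat -> R) : 0 < x -> uniqueness x ->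
  (fun n => lam n * D n) @ \oo --> act x ->
  (fun n => scaled_lnZ n (lam n)) @ \oo --> Phi x.
Proof.
move=> x0 ux hlam; apply/cvgrPdist_le => d d0.
have d2 : 0 < d / 2 by rewrite divr_gt0.
have /cvgrPdist_le hc : Phi @ x --> Phi x by exact: continuous_free_energy.
have : \forall y \near x, [/\ 0 < y, uniqueness y & `|Phi x - Phi y| <= d / 2].
  near=> y; split.
  - by near: y; apply: (cvgr_gt x) => //; exact: cvg_id.
  - near: y; apply: (cvgr_lt (k.-1%:R * zeta * act x ^+ k.-1)) => //.
    apply: cvgM; first exact: cvg_cst.
    apply: (@cvg_comp _ _ _ act (fun u => u ^+ k.-1)).
      exact: continuous_activity.
    exact: exprn_continuous.
  - by near: y; exact: hc.
move=> /nbhs_ballP[e /= e0 he].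
have e2 : 0 < e / 2 by rewrite divr_gt0.
have [xl0 ul Pl] : [/\ 0 < x - e / 2, uniqueness (x - e / 2) & `|Phi x - Phi (x - e / 2)| <= d / 2].
  by apply: he; rewrite /ball /= opprB addrC subrK gtr0_norm //; lra.
have [xr0 ur Pr] : [/\ 0 < x + e / 2, uniqueness (x + e / 2) & `|Phi x - Phi (x + e / 2)| <= d / 2].
  by apply: he; rewrite /ball /= opprD addrA subrr add0r normrN gtr0_norm //; lra.
have al : act (x - e / 2) < act x by apply: activity_lt => //; lra.
have ar : act x < act (x + e / 2) by apply: activity_lt => //; lra.
near=> n.
have Dn : 0 < D n by near: n; exact: Dpos.
have Nn : (0 < N n)%N by near: n; exact: Npos.
have l1 : act (x - e / 2) / D n <= lam n.
  by rewrite ler_pdivrMr //; apply/ltW; near: n; exact: (cvgr_gt (act x)).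
have l2 : lam n <= act (x + e / 2) / D n.
  by rewrite ler_pdivlMr //; apply/ltW; near: n; exact: (cvgr_lt (act x)).
have l0 : 0 <= act (x - e / 2) / D n by rewrite divr_ge0 ?(ltW Dn) // ltW // activity_gt0.
have mono u v : 0 <= u -> u <= v -> scaled_lnZ n u <= scaled_lnZ n v.
  move=> u0 uv; rewrite ler_wpM2l ?divr_ge0 ?(ltW Dn) //.
  rewrite ler_ln ?posrE; first exact: Zpart_mono.
    exact: lt_le_trans (Zpart_ge1 k_gt0 (Eunif n) u0 zeta01).
  exact: lt_le_trans (Zpart_ge1 k_gt0 (Eunif n) (le_trans u0 uv) zeta01).
have A1 : `|scaled_lnZ n (act (x - e / 2) / D n) - Phi (x - e / 2)| <= d / 2.
  by near: n; exact: scaled_lnZ_approx.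
have A2 : `|scaled_lnZ n (act (x + e / 2) / D n) - Phi (x + e / 2)| <= d / 2.
  by near: n; exact: scaled_lnZ_approx.
have m1 := mono _ _ l0 l1.
have m2 := mono _ _ (le_trans l0 l1) l2.
move: Pl Pr A1 A2 m1 m2; rewrite !ler_norml.
move: (scaled_lnZ n _) (scaled_lnZ n _) (scaled_lnZ n _) (Phi x) (Phi _) (Phi _).
clear - d0; move=> a b c f g h' /andP[? ?] /andP[? ?] /andP[? ?] /andP[? ?] ? ?.
by apply/andP; split; lra.
Unshelve. all: by end_near. Qed.
End FreeEnergyLimit.

(** * Lower tails *)

Lemma two_paths_arith (R : realType) (q D eps n : R) :
  q * D ^+ 2 <= D + n * (eps * D) -> D <= eps * D * D ->
  (q - eps) * D * D <= n * eps * D.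
Proof. by rewrite expr2 => h1 h2; lra. Qed.

Section LowerTailOneHypergraph.
Variables (R : realType) (N k : nat) (E : {set {set 'I_N}}).
Hypotheses (k_ge2 : (2 <= k)%N) (Eunif : uniform E k).
Implicit Types (S : {set 'I_N}) (lam zeta t : R).

Let k_gt0 : (0 < k)%N. Proof. exact: leq_trans k_ge2. Qed.

Definition Zle lam t : R :=
  \sum_(S : {set 'I_N}) (if (Xcount E S)%:R <= t then lam ^+ #|S| else 0).

Lemma odds_weight (p : R) S : p < 1 ->
  p ^+ #|S| * (1 - p) ^+ (N - #|S|) = (1 - p) ^+ N * (p / (1 - p)) ^+ #|S|.
Proof.
move=> p1; have SN : (#|S| <= N)%N by rewrite -[leqRHS]card_ord max_card.
have q0 : (1 - p) ^+ #|S| != 0 by rewrite expf_neq0 // subr_eq0 eq_sym lt_eqF.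
have -> : (1 - p) ^+ N = (1 - p) ^+ (N - #|S|) * (1 - p) ^+ #|S|.
  by rewrite -exprD subnK.
by rewrite exprMn exprVn mulrACA mulfV // mulr1 mulrC.
Qed.

Lemma probXle_odds (p t : R) : p < 1 ->
  probXle E p t = (1 - p) ^+ N * Zle (p / (1 - p)) t.
Proof.
move=> p1; rewrite /probXle /Zle mulr_sumr; apply: eq_bigr => S _.
by case: ifP => _; rewrite ?mulr0 // odds_weight.
Qed.

(** Since [0 ^+ 0 = 1], the factor at [zeta = 1] is the indicator of [X = 0]: this tail is exactly a
    partition function. *)
Lemma Zle0_Zpart lam : Zle lam 0 = Zpart E lam 1.
Proof.
apply: eq_bigr => S _; rewrite subrr expr0n.
rewrite -[X in (_ <= X)%R]/(0%:R) ler_nat leqn0.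
by case: (Xcount E S == 0%N); rewrite ?mulr1 ?mulr0.
Qed.

Lemma probX0_probXle (p : R) : probX0 E p = probXle E p 0.
Proof.
by apply: eq_bigr => S _; rewrite -[X in (_ <= X)%R]/(0%:R) ler_nat leqn0.
Qed.

Lemma Zle_ge1 lam t : 0 <= lam -> 0 <= t -> 1 <= Zle lam t.
Proof.
move=> lam0 t0; rewrite /Zle (bigD1 finset.set0) //= (Xcount0 k_gt0 Eunif) t0 finset.cards0 expr0.
by rewrite lerDl sumr_ge0 // => S _; case: ifP => _ //; exact: exprn_ge0.
Qed.

Lemma tilt_expR zeta n : zeta < 1 -> (1 - zeta) ^+ n = expR (ln (1 - zeta) * n%:R).
Proof.
by move=> z1; rewrite mulrC expRM_natl lnK // posrE subr_gt0.
Qed.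

Lemma Zle_upper lam zeta t : 0 <= lam -> 0 <= zeta -> zeta < 1 ->
  Zle lam t <= expR (- (ln (1 - zeta) * t)) * Zpart E lam zeta.
Proof.
move=> lam0 z0 z1; rewrite /Zpart mulr_sumr; apply: ler_sum => S _.
have th : ln (1 - zeta) <= 0 by apply: ln_le0; rewrite gerBl.
rewrite mulrCA tilt_expR // -expRD.
case: ifP => [h|_]; last by rewrite mulr_ge0 ?exprn_ge0 ?expR_ge0.
rewrite -[leLHS]mulr1 ler_wpM2l ?exprn_ge0 // -[leLHS]expR0 ler_expR.
by rewrite [leRHS]addrC subr_ge0; exact: ler_wnM2l.
Qed.

(** Holds for each [S] separately. For [X > t] the weight [(1 - z1)^X] is dominated by the term in
    [z], for [X < t'] by the term in [z2]; for [t' <= X <= t] it is at most [(1 - z1)^t'], which the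
    prefactor cancels. *)
Lemma Zle_lower lam z z1 z2 t t' : 0 <= lam -> 0 <= z -> z < z1 -> z1 < z2 -> z2 < 1 ->
  expR (- (ln (1 - z1) * t')) *
   (Zpart E lam z1 - expR ((ln (1 - z1) - ln (1 - z)) * t) * Zpart E lam z
     - expR ((ln (1 - z1) - ln (1 - z2)) * t') * Zpart E lam z2) <= Zle lam t.
Proof.
move=> lam0 z0 zz1 z12 z21.
have z11 : z1 < 1 by exact: lt_trans z21.
have zl1 : z < 1 by exact: lt_trans z11.
have th1 : ln (1 - z1) <= ln (1 - z).
  by rewrite ler_ln ?posrE ?subr_gt0 // lerD2l lerN2 ltW.
have th2 : ln (1 - z2) <= ln (1 - z1).
  by rewrite ler_ln ?posrE ?subr_gt0 // lerD2l lerN2 ltW.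
have th0 : ln (1 - z1) <= 0 by apply: ln_le0; rewrite gerBl ltW // (le_lt_trans z0).
rewrite /Zpart !mulr_sumr -!sumrB mulr_sumr; apply: ler_sum => S _.
rewrite !tilt_expR //; move: th1 th2 th0.
move: (ln (1 - z1)) (ln (1 - z2)) (ln (1 - z)) => a b c ca ab a0.
set X : R := (Xcount E S)%:R; set w := lam ^+ _.
have w0 : 0 <= w by exact: exprn_ge0.
have -> : expR (- (a * t')) * (w * expR (a * X) - expR ((a - c) * t) * (w * expR (c * X))
     - expR ((a - b) * t') * (w * expR (b * X))) =
  w * (expR (- (a * t')) * (expR (a * X) - expR ((a - c) * t + c * X) -
     expR ((a - b) * t' + b * X))).
  by rewrite !expRD; ring.
have [Xt|tX] := leP X t; last first.
  rewrite mulr_ge0_le0 // mulr_ge0_le0 ?expR_ge0 // subr_le0.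
  apply: (@le_trans _ _ 0); last exact: expR_ge0.
  rewrite subr_le0 ler_expR.
  have ac0 : a - c <= 0 by rewrite subr_le0.
  have h := ler_wnM2l ac0 (ltW tX).
  by rewrite -lerBlDr -mulrBl.
rewrite -[leRHS]mulr1 ler_wpM2l //.
have [t'X|Xt'] := leP t' X.
  apply: (@le_trans _ _ (expR (- (a * t')) * expR (a * X))).
    rewrite ler_wpM2l ?expR_ge0 // -addrA gerDl -opprD oppr_le0.
    by rewrite addr_ge0 ?expR_ge0.
  by rewrite -expRD -[leRHS]expR0 ler_expR [leLHS]addrC subr_le0; exact: ler_wnM2l.
apply: (@le_trans _ _ 0); last exact: ler01.
rewrite mulr_ge0_le0 ?expR_ge0 // subr_le0.
apply: (@le_trans _ _ (expR (a * X))); first by rewrite gerBl expR_ge0.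
have ab0 : 0 <= a - b by rewrite subr_ge0.
have h := ler_wpM2l ab0 (ltW Xt').
by rewrite ler_expR -lerBlDr -mulrBl.
Qed.

Lemma handshake : (\sum_(u : 'I_N) codeg E [set u]%SET = k * #|E|)%N.
Proof.
transitivity (\sum_(u : 'I_N) \sum_(e in E | u \in e) 1)%N.
  apply: eq_bigr => u _; rewrite sum1_card /codeg; apply: eq_card => e.
  by rewrite !inE finset.sub1set.
rewrite (exchange_big_dep (fun e => e \in E)) //=; last by move=> u e _ /andP[].
rewrite (eq_bigr (fun=> k)) => [|e eE]; first by rewrite sum_nat_const mulnC.
by rewrite (eq_bigl (fun u => u \in e)) ?sum1_card ?(card_edge Eunif eE) // => u; rewrite eE.
Qed.

Section Sparse.
Variables (D eps : R).
Hypotheses (eps0 : 0 < eps) (eps1 : eps <= 1) (N_gt0 : (0 < N)%N).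
Hypothesis tree : near_treelike k E D eps.

Let D_gt0 : 0 < D.
Proof. by case: tree => h _ _ _ _; rewrite -(pmulr_rgt0 _ eps0); exact: lt_le_trans h. Qed.

(** With its companion for [k = 2], shows that [N] is much larger than [D]. Every edge at [u]
    contains a second vertex, so the degree of [u] is at most a sum of pair codegrees, each at most
    [eps D^(k-2)]. *)
Lemma vertices_ge_k3 : (3 <= k)%N -> (1 - eps) * D <= N%:R * eps.
Proof.
move=> k3; case: tree => epsD maxD GD degD degD'.
pose u : 'I_N := Ordinal N_gt0.
have sub : [set e in E | [set u]%SET \subset e]%SET \subset
   \bigcup_(a | a != u) [set e in E | [set u; a]%SET \subset e]%SET.
  apply/fintype.subsetP => e; rewrite inE finset.sub1set => /andP[eE ue].
  have : (0 < #|e :\ u|)%N.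
    move: (card_edge Eunif eE); rewrite (cardsD1 u) ue add1n => ke.
    by rewrite -ltnS ke.
  rewrite card_gt0 => /set0Pn[a]; rewrite !inE => /andP[au ae].
  apply/bigcupP; exists a => //.
  by rewrite inE eE finset.subUset !finset.sub1set ue.
have pair a : a != u -> (codeg E [set u; a]%SET)%:R <= eps * D ^+ (k - 2).
  move=> au; have c2 : #|[set u; a]%SET| = 2%N by rewrite cards2 eq_sym au.
  rewrite -c2; apply: codegD maxD _ _ _; rewrite ?c2 //.
  by rewrite -subn1 leq_subRL // (leq_trans _ k3).
have : (1 - eps) * D ^+ k.-1 <= N%:R * (eps * D ^+ (k - 2)).
  apply: le_trans (degD' u) _.
  apply: (@le_trans _ _ (\sum_(a | a != u) codeg E [set u; a]%SET)%:R).
    by rewrite ler_nat (leq_trans (subset_leq_card sub)) // card_bigcup_le.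
  rewrite natr_sum.
  apply: (@le_trans _ _ (\sum_(a : 'I_N) eps * D ^+ (k - 2))).
    rewrite big_mkcond /=; apply: ler_sum => a _; case: ifP => [/pair//|_].
    by rewrite mulr_ge0 ?exprn_ge0 // ltW.
  by rewrite sumr_const card_ord mulr_natl.
have -> : k.-1 = (k - 2).+1 by rewrite -subn1 -subSn.
by rewrite exprS !mulrA ler_pM2r // exprn_gt0.
Qed.

(** Count walks of length two from [u]: there are at least [((1 - eps) D)^2], while at most [D]
    return to [u] and at most [Gamma <= eps D] end at any given other vertex. *)
Lemma vertices_ge_k2 : k = 2%N -> ((1 - eps) ^+ 2 - eps) * D <= N%:R * eps.
Proof.
move=> k2; case: tree => epsD maxD GD degD degD'.
move: GD degD degD'; rewrite k2 expr1 => GD degD degD'.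
pose u : 'I_N := Ordinal N_gt0.
pose adj (v w : 'I_N) : nat := [set v; w]%SET \in E.
have adjE w : (codeg E [set w]%SET <= \sum_a adj a w)%N.
  have sub : [set e in E | [set w]%SET \subset e]%SET \subset
     [set [set a; w]%SET | a in [set a | [set a; w]%SET \in E]%SET]%SET.
    apply/fintype.subsetP => e; rewrite inE finset.sub1set => /andP[eE we].
    have ce := card_edge Eunif eE.
    have /cards1P[a ea] : #|e :\ w| == 1%N.
      by move: ce; rewrite (cardsD1 w) we k2 add1n => -[->].
    have ee : e = [set a; w]%SET by rewrite -(finset.setD1K we) ea finset.setUC.
    by apply/imsetP; exists a => //; rewrite inE -ee.
  apply: leq_trans (subset_leq_card sub) _; apply: leq_trans (leq_imset_card _ _) _.
  rewrite -sum1_card big_mkcond /=; apply: leq_sum => a _.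
  by rewrite inE /adj; case: (_ \in _).
have common a : a != u -> (\sum_w adj u w * adj a w <= Gamma E k)%N.
  move=> au; rewrite k2.
  pose FF (vv : 'I_N * 'I_N) := #|[set S : {set 'I_N} |
     (#|S| == 1)%N && (vv.1 |: S \in E) && (vv.2 |: S \in E)]%SET|.
  apply: (@leq_trans (FF (a, u))); last first.
    apply: leq_trans (@leq_bigmax_cond _ (fun vv => vv.1 != vv.2) FF (a, u) au) _.
    rewrite leq_eqVlt; apply/orP; left; apply/eqP; apply: eq_bigr => vv' _.
    apply: eq_card => S; rewrite inE; apply/idP/idP.
      by move=> h; rewrite in_setE.
    by rewrite in_setE.
  apply: (@leq_trans #|[set [set w]%SET | w in
     [set w | ([set u; w]%SET \in E) && ([set a; w]%SET \in E)]%SET]%SET|).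
    rewrite card_imset; last exact: finset.set1_inj.
    rewrite -sum1_card [leqRHS]big_mkcond /=; apply: leq_sum => w _.
    by rewrite inE /adj; case: (_ \in _); case: (_ \in _).
  apply: subset_leq_card; apply/fintype.subsetP => S /imsetP[w].
  by rewrite inE => /andP[h1 h2] ->; rewrite inE cards1 eqxx h1 h2.
have selfa : (\sum_w adj u w * adj u w <= codeg E [set u]%SET)%N.
  apply: (@leq_trans (\sum_(w | [set u; w]%SET \in E) 1)).
    rewrite [leqRHS]big_mkcond /=; apply: leq_sum => w _.
    by rewrite /adj; case: (_ \in _).
  rewrite sum1_card /codeg.
  rewrite -(@card_in_imset _ _ (fun w => [set u; w]%SET)).
    apply: subset_leq_card; apply/fintype.subsetP => e /imsetP[w uw ->].
    have uwE : [set u; w]%SET \in E by [].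
    by rewrite inE uwE finset.sub1set !inE eqxx.
  move=> w w'; rewrite !unfold_in => /(card_edge Eunif) h1 /(card_edge Eunif) h2 uw.
  have w1 : w \in [set u; w']%SET by rewrite -uw !inE eqxx orbT.
  move: w1; rewrite !inE => /orP[/eqP wu|/eqP//].
  by move: h1; rewrite wu finset.setUid cards1 k2.
have lower : ((1 - eps) * D) ^+ 2 <= (\sum_w adj u w * (\sum_a adj a w))%:R :> R.
  apply: (@le_trans _ _ (((1 - eps) * D) * (\sum_w adj u w)%:R)).
    rewrite expr2 ler_wpM2l ?mulr_ge0 ?subr_ge0 ?(ltW D_gt0) //.
    apply: le_trans (degD' u) _; rewrite ler_nat; apply: leq_trans (adjE u) _.
    by apply: leq_sum => a _; rewrite /adj finset.setUC.
  rewrite !natr_sum mulr_sumr; apply: ler_sum => w _.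
  rewrite natrM mulrC ler_wpM2l // (le_trans (degD' w)) // ler_nat; exact: adjE.
have upper : (\sum_w adj u w * (\sum_a adj a w))%:R <= D + N%:R * (eps * D).
  have -> : (\sum_w adj u w * (\sum_a adj a w) = \sum_a \sum_w adj u w * adj a w)%N.
    by rewrite exchange_big /=; apply: eq_bigr => w _; rewrite big_distrr.
  rewrite (bigD1 u) //= natrD; apply: lerD.
    by apply: le_trans (degD u); rewrite ler_nat.
  rewrite natr_sum; apply: (@le_trans _ _ (\sum_(a : 'I_N) eps * D)).
    rewrite big_mkcond /=; apply: ler_sum => a _; case: ifP => [au|_].
      by apply: le_trans GD; rewrite -k2 ler_nat common.
    by rewrite mulr_ge0 ?ltW.
  by rewrite sumr_const card_ord mulr_natl.
have h := le_trans lower upper; rewrite exprMn in h.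
rewrite -(ler_pM2r D_gt0).
have hD : D <= eps * D * D by rewrite ler_peMl // ltW.
exact: two_paths_arith h hD.
Qed.
End Sparse.
End LowerTailOneHypergraph.

(** * The curve of constant activity *)

Section TiltCurve.
Variables (R : realType) (k : nat).
Hypothesis k_ge2 : (2 <= k)%N.
Local Notation act := (activity k).
Local Notation Phi := (free_energy k).

Let k_gt0 : (0 < k)%N. Proof. exact: leq_trans k_ge2. Qed.

(* Phi z' x' is the maximum over q of q - q ln (q / c) - z' q^k / k, attained at q = x';
   evaluating at q = x gives the tangent line in ln (1 - z) at z. *)
Lemma free_energy_tangent (z z' x x' : R) : z < 1 -> 0 <= z' -> z' < 1 -> z != z' ->
  0 < x -> 0 < x' -> act z x = act z' x' ->
  Phi z x + (1 - z) * x ^+ k / k%:R * (ln (1 - z') - ln (1 - z)) < Phi z' x'.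
Proof.
move=> z1 z'0 z'1 zz' x0 x'0 axx.
have kp : 0 < k%:R :> R by rewrite ltr0n.
have kE : k = k.-1.+1 by rewrite prednK.
have lnE : ln x + z * x ^+ k.-1 = ln x' + z' * x' ^+ k.-1.
  by rewrite -!ln_activity // axx.
have h1 := ln_sub_le x'0 x0.
have h2 := weighted_amgm k.-1 (ltW x0) (ltW x'0).
rewrite -kE in h2.
have h2' : x * x' ^+ k.-1 <= (1 - k%:R^-1) * x' ^+ k + x ^+ k / k%:R.
  rewrite -(ler_pM2l kp); apply: le_trans h2 _.
  rewrite mulrDr [_ * (x ^+ k / _)]mulrCA mulfV ?gt_eqF // mulr1 lerD2r.
  rewrite mulrA mulrBr mulr1 mulfV ?gt_eqF // ler_wpM2r ?exprn_ge0 ?(ltW x'0) //.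
  by rewrite {2}kE -natr1 addrK.
have h3 := ler_wpM2l z'0 h2'.
have h4 : (1 - z) * (ln (1 - z') - ln (1 - z)) < z - z'.
  have a0 : 0 < 1 - z by rewrite subr_gt0.
  have b0 : 0 < 1 - z' by rewrite subr_gt0.
  rewrite -ln_div ?posrE //.
  have v0 : ln ((1 - z') / (1 - z)) != 0.
    rewrite ln_eq0 ?divr_gt0 //; apply: contra zz' => /eqP h.
    have e : 1 - z' = 1 - z by rewrite -[LHS](@divfK _ (1 - z)) ?gt_eqF // h mul1r.
    by apply/eqP; move: e; clear; lra.
  have := expR_gt1Dx v0; rewrite lnK ?posrE ?divr_gt0 //.
  rewrite -(ltr_pM2l a0) [ltRHS]mulrC divfK ?gt_eqF // mulrDr mulr1.
  by move: (_ * ln _) => w h; lra.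
have xk : x ^+ k = x * x ^+ k.-1 by rewrite -exprS -kE.
have c0 : 0 < x ^+ k / k%:R by rewrite divr_gt0 // exprn_gt0.
have h5 := h4; rewrite -(ltr_pM2r c0) in h5.
have -> : (1 - z) * x ^+ k / k%:R * (ln (1 - z') - ln (1 - z)) =
   (1 - z) * (ln (1 - z') - ln (1 - z)) * (x ^+ k / k%:R) by ring.
apply: lt_le_trans (_ : Phi z x + (z - z') * (x ^+ k / k%:R) <= _); first by rewrite ltrD2l.
rewrite /free_energy.
have e1 : x * (ln x' - ln x) = x * (z * x ^+ k.-1) - x * (z' * x' ^+ k.-1).
  have -> : ln x' - ln x = z * x ^+ k.-1 - z' * x' ^+ k.-1.
    have aux (a b d e : R) : a + d = b + e -> b - a = d - e by move=> h; lra.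
    exact: aux lnE.
  by rewrite mulrBr.
have e2 : x ^+ k * (1 - k%:R^-1) * z = x * (z * x ^+ k.-1) - z * (x ^+ k / k%:R).
  by rewrite xk; ring.
have e3 : z' * (x * x' ^+ k.-1) = x * (z' * x' ^+ k.-1) by ring.
have e4 : x' ^+ k * (1 - k%:R^-1) * z' = z' * ((1 - k%:R^-1) * x' ^+ k) by ring.
rewrite e2 e4; rewrite e1 in h1; rewrite e3 mulrDr in h3.
rewrite mulrBl; have aux (a b d e f g : R) : a - b <= x' - x -> b <= f + g ->
    x + (a - d) + (d - g) <= x' + f by move=> ? ?; lra.
exact: aux h1 h3.
Qed.

(** The [zeta] at which activity [c] produces density [y]. It is elementary in [y], whereas the
    density as a function of [zeta] needs the Lambert function. *)
Definition tilt (c y : R) : R := ln (c / y) / y ^+ k.-1.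

Lemma activity_tilt (c y : R) : 0 < c -> 0 < y -> act (tilt c y) y = c.
Proof.
move=> c0 y0; rewrite /activity /tilt divfK ?gt_eqF ?exprn_gt0 //.
by rewrite lnK ?posrE ?divr_gt0 // mulrC divfK ?gt_eqF.
Qed.

Lemma tilt_activity (z x : R) : 0 < x -> tilt (act z x) x = z.
Proof.
move=> x0; rewrite /tilt /activity [x * _ / x]mulrAC divff ?gt_eqF // mul1r expRK.
by rewrite mulfK ?gt_eqF ?exprn_gt0.
Qed.

Lemma tilt_anti (z z' x x' : R) : 0 <= z' -> 0 < x -> x < x' -> act z x = act z' x' -> z' < z.
Proof.
move=> z'0 x0 xx' axx; rewrite ltNge; apply/negP => zz'.
have := activity_lt k z'0 x0 xx'; rewrite -axx; apply/negP; rewrite -leNgt.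
rewrite ler_wpM2l ?(ltW x0) // ler_expR ler_wpM2r // exprn_ge0 //; exact: ltW.
Qed.

Lemma cvg_tilt (c x : R) : 0 < c -> 0 < x -> tilt c y @[y --> x] --> tilt c x.
Proof.
move=> c0 x0; apply: cvgM; last first.
  by apply: cvgV; [rewrite expf_neq0 // gt_eqF | exact: exprn_continuous].
apply: (@cvg_comp _ _ _ (fun y => c / y) (fun u => ln u)); last first.
  by apply: continuous_ln; rewrite divr_gt0.
apply: cvgM; first exact: cvg_cst.
by apply: cvgV; [rewrite gt_eqF | exact: cvg_id].
Qed.
End TiltCurve.

Lemma eighth_bounds (R : realType) (d : R) : 0 < d -> d <= 8^-1 ->
  2^-1 <= 1 - d /\ 2^-1 <= (1 - d) ^+ 2 - d.
Proof. by move=> d0 d8; split; [lra | nra]. Qed.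

(** * Scaling limits of the elementary quantities *)

Section LowerTail.
Variables (R : realType) (k : nat) (N : nat -> nat).
Variables (E : forall n, {set {set 'I_(N n)}}) (D p : nat -> R) (c : R).
Hypotheses (k_ge2 : (2 <= k)%N) (Eunif : forall n, uniform (E n) k).
Hypothesis Etree : forall eps : R, 0 < eps ->
  \forall n \near \oo, near_treelike k (E n) (D n) eps.
Hypothesis Npos : \forall n \near \oo, (0 < N n)%N.
Hypotheses (c_gt0 : 0 < c) (p01 : forall n, 0 <= p n <= 1).
Hypothesis pD : (fun n => p n * D n) @ \oo --> c.

Let k_gt0 : (0 < k)%N. Proof. exact: leq_trans k_ge2. Qed.
Let Dpos : \forall n \near \oo, 0 < D n. Proof. exact: Dpos Etree. Qed.
Local Notation ratio := (fun n => D n / (N n)%:R).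

Lemma cvg_invD : (fun n => (D n)^-1) @ \oo --> (0 : R).
Proof.
apply/cvgrPdist_le => e e0; apply: filterS2 Dpos (Etree e0) => n Dn [h _ _ _ _].
rewrite sub0r normrN gtr0_norm ?invr_gt0 //.
by rewrite -[leLHS]mul1r ler_pdivrMr.
Qed.

Lemma cvg_ratio : ratio @ \oo --> (0 : R).
Proof.
apply/cvgrPdist_le => e e0.
(* The bound [1/8] keeps the coefficients [1 - d] and [(1 - d)^2 - d] at least [1/2]; the bound
   [e / 2] absorbs that factor. *)
pose d := Num.min (8^-1) (e / 2).
have d0 : 0 < d by rewrite lt_min invr_gt0 ltr0n divr_gt0.
have d8 : d <= 8^-1 by rewrite ge_min lexx.
have de : d <= e / 2 by rewrite ge_min lexx orbT.
have d1 : d <= 1 by apply: (le_trans d8); rewrite invf_le1 ?ler1n.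
apply: filterS3 Dpos Npos (Etree d0) => n Dn Nn tn.
have N0 : 0 < (N n)%:R :> R by rewrite ltr0n.
rewrite sub0r normrN gtr0_norm ?divr_gt0 // ler_pdivrMr //.
have h : 2^-1 * D n <= (N n)%:R * d.
  have [k3|k2] := leqP 3 k.
    apply: le_trans (vertices_ge_k3 k_ge2 (Eunif n) d0 Nn tn k3).
    by rewrite ler_wpM2r ?(ltW Dn) //; case: (eighth_bounds d0 d8).
  have ke : k = 2%N by apply/eqP; rewrite eqn_leq k_ge2 -ltnS k2.
  apply: le_trans (vertices_ge_k2 (Eunif n) d0 d1 Nn tn ke).
  by rewrite ler_wpM2r ?(ltW Dn) //; case: (eighth_bounds d0 d8).
have h2 : (N n)%:R * d <= (N n)%:R * (e / 2) by rewrite ler_wpM2l // ltW.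
by move: (le_trans h h2); rewrite mulrA => h3; lra.
Qed.

Lemma cvg_p0 : p @ \oo --> (0 : R).
Proof.
have h := cvgM pD cvg_invD; rewrite mulr0 in h.
have e : {near \oo, (fun n => p n * D n * (D n)^-1) =1 p}.
  by apply: filterS Dpos => n Dn /=; rewrite -mulrA mulfV ?mulr1 // gt_eqF.
exact: cvg_trans (near_eq_cvg e) (h _).
Qed.

Lemma cvg_odds : (fun n => p n / (1 - p n) * D n) @ \oo --> c.
Proof.
have -> : (fun n => p n / (1 - p n) * D n) = (fun n => p n * D n * (1 - p n)^-1).
  by apply/funext => n; rewrite mulrAC.
rewrite -[c]mulr1 -[X in c * X]invr1 -[X in X^-1]subr0.
apply: cvgM => //; apply: cvgV; first by rewrite subr0 oner_neq0.
by apply: cvgB; [exact: cvg_cst | exact: cvg_p0].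
Qed.

Lemma p_lt1 : \forall n \near \oo, p n < 1.
Proof. by apply: (cvgr_lt 0); [exact: cvg_p0 | exact: ltr01]. Qed.

(** Source of the term [- c] in the theorem: the normalisation [(1 - p)^N] between [probXle] and
    [Zle]. It rests on [- p / (1 - p) <= ln (1 - p) <= - p]. *)
Lemma cvg_ln_empty : (fun n => D n * ln (1 - p n)) @ \oo --> - c.
Proof.
apply: (@squeeze_cvgr _ _ _ _ (fun n => - (p n / (1 - p n) * D n)) (fun n => - (p n * D n))).
- apply: filterS2 Dpos p_lt1 => n Dn p1.
  have q0 : 0 < 1 - p n by rewrite subr_gt0.
  have [p0 _] := andP (p01 n).
  have -> : D n * ln (1 - p n) = ln (1 - p n) * D n by rewrite mulrC.
  apply/andP; split.
    have := ln_sub_le ltr01 q0; rewrite ln1 sub0r => h.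
    have : - ln (1 - p n) <= p n / (1 - p n).
      rewrite ler_pdivlMr // mulrC; apply: (le_trans h).
      by rewrite opprB [leLHS]addrC subrK.
    by move=> h2; rewrite -mulNr ler_pM2r // lerNl.
  by rewrite -mulNr ler_pM2r //; apply: le_ln1Dx; rewrite ltrN2.
- by apply: cvgN; exact: cvg_odds.
- exact: cvgN.
Qed.

(** By double counting and near-regularity, [k |E|] is asymptotic to [N D^(k-1)]. *)
Lemma cvg_expected_edges :
  (fun n => ratio n * (#|E n|%:R * p n ^+ k)) @ \oo --> c ^+ k / k%:R.
Proof.
have kp : 0 < k%:R :> R by rewrite ltr0n.
have h1 : (fun n => #|E n|%:R / ((N n)%:R * D n ^+ k.-1)) @ \oo --> (k%:R^-1 : R).
  apply/cvgrPdist_le => e e0; apply: filterS3 Dpos Npos (Etree e0) => n Dn Nn.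
  case=> _ _ _ deg1 deg2.
  have N0 : 0 < (N n)%:R :> R by rewrite ltr0n.
  have D0 : 0 < D n ^+ k.-1 by rewrite exprn_gt0.
  have hs : k%:R * #|E n|%:R = \sum_(u : 'I_(N n)) (codeg (E n) [set u]%SET)%:R :> R.
    by rewrite -natrM -(handshake (Eunif n)) natr_sum.
  have u1 : k%:R * #|E n|%:R <= (N n)%:R * D n ^+ k.-1.
    rewrite hs mulr_natl -[X in _ *+ X]card_ord -sumr_const; exact: ler_sum.
  have u2 : (1 - e) * ((N n)%:R * D n ^+ k.-1) <= k%:R * #|E n|%:R.
    rewrite hs mulrCA mulr_natl -[X in _ *+ X]card_ord -sumr_const; exact: ler_sum.
  have ND : 0 < (N n)%:R * D n ^+ k.-1 by rewrite mulr_gt0.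
  have v1 : k%:R * (#|E n|%:R / ((N n)%:R * D n ^+ k.-1)) <= 1.
    by rewrite mulrA ler_pdivrMr // mul1r.
  have v2 : 1 - e <= k%:R * (#|E n|%:R / ((N n)%:R * D n ^+ k.-1)).
    by rewrite mulrA ler_pdivlMr.
  set q := _ / _ in v1 v2 *.
  have k1 : 1 <= k%:R :> R by rewrite ler1n.
  apply: (@le_trans _ _ (k%:R * `|k%:R^-1 - q|)); first by rewrite ler_peMl.
  rewrite -{1}(gtr0_norm kp) -normrM mulrBr mulfV ?gt_eqF // ler_norml.
  have aux (w : R) : w <= 1 -> 1 - e <= w -> - e <= 1 - w <= e.
    by move=> ? ?; apply/andP; split; lra.
  exact: aux v1 v2.
have h2 : (fun n => (p n * D n) ^+ k) @ \oo --> c ^+ k.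
  by apply: (@cvg_comp _ _ _ (fun n => p n * D n) (fun u : R => u ^+ k)) pD _; exact: exprn_continuous.
have h := cvgM h1 h2; rewrite mulrC.
have e : {near \oo, (fun n => #|E n|%:R / ((N n)%:R * D n ^+ k.-1) * (p n * D n) ^+ k)
   =1 (fun n => ratio n * (#|E n|%:R * p n ^+ k))}.
  apply: filterS2 Dpos Npos => n Dn Nn /=.
  have N0 : (N n)%:R != 0 :> R by rewrite pnatr_eq0 -lt0n.
  have D0 : D n ^+ k.-1 != 0 by rewrite expf_neq0 // gt_eqF.
  rewrite exprMn (_ : D n ^+ k = D n * D n ^+ k.-1); last by rewrite -exprS prednK.
  by field; rewrite D0 N0.
exact: cvg_trans (near_eq_cvg e) (h _).
Qed.
End LowerTail.

Lemma quarter_arith (R : realType) (w a b : R) :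
  0 < w -> a <= w / 4 -> b <= w / 4 -> w / 4 <= w - a - b.
Proof. by move=> *; lra. Qed.

Lemma tilted_limit_arith (R : realType) (F F1 th w tau s2 d1 d : R) :
  F + tau * (w - th) < F1 -> tau - d1 < s2 -> th - 1 < w -> w <= 0 ->
  (1 - th) * d1 = d / 2 -> 0 < d1 -> F - th * tau - d <= F1 - w * s2 - d / 2.
Proof.
move=> h1 h2 h3 h4 h5 d10.
have h6 : w * s2 <= w * (tau - d1) by apply: ler_wnM2l => //; exact: ltW.
have h7 : (th - 1) * d1 <= w * d1 by apply: ler_wpM2r; apply: ltW.
by lra.
Qed.

(** * Tilting and the lower-tail limit *)

Section LowerTailLimit.
Variables (R : realType) (k : nat) (N : nat -> nat).
Variables (E : forall n, {set {set 'I_(N n)}}) (D p : nat -> R) (c : R).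
Hypotheses (k_ge2 : (2 <= k)%N) (Eunif : forall n, uniform (E n) k).
Hypothesis Etree : forall eps : R, 0 < eps ->
  \forall n \near \oo, near_treelike k (E n) (D n) eps.
Hypothesis Npos : \forall n \near \oo, (0 < N n)%N.
Hypotheses (c_gt0 : 0 < c) (p01 : forall n, 0 <= p n <= 1).
Hypothesis pD : (fun n => p n * D n) @ \oo --> c.

Let k_gt0 : (0 < k)%N. Proof. exact: leq_trans k_ge2. Qed.
Let Dpos' : \forall n \near \oo, 0 < D n. Proof. exact: Dpos Etree. Qed.
Let ratio n := D n / (N n)%:R.
Let lam n := p n / (1 - p n).
Let cvg_ratio' : ratio @ \oo --> (0 : R).
Proof. exact: cvg_ratio k_ge2 Eunif Etree Npos. Qed.
Let p_lt1' : \forall n \near \oo, p n < 1.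
Proof. exact: p_lt1 Etree pD. Qed.

Lemma ratio_gt0 : \forall n \near \oo, 0 < ratio n.
Proof.
by apply: filterS2 Dpos' Npos => n Dn Nn; rewrite divr_gt0 // ltr0n.
Qed.

Lemma lam_ge0 : \forall n \near \oo, 0 <= lam n.
Proof.
apply: filterS p_lt1' => n p1; rewrite divr_ge0 //; first by case/andP: (p01 n).
by rewrite subr_ge0 ltW.
Qed.

Lemma scaled_lnZ_odds_cvg z x : 0 <= z <= 1 -> 0 < x -> activity k z x = c ->
  uniqueness k z x ->
  (fun n => ratio n * ln (Zpart (E n) (lam n) z)) @ \oo --> free_energy k z x.
Proof.
move=> z01 x0 axc ux; apply: (scaled_lnZ_cvg k_ge2 Eunif Etree Npos z01 x0 ux).
by rewrite axc; exact: cvg_odds Etree pD.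
Qed.

Lemma probXle_cvg (t : nat -> R) (l : R) : (forall n, 0 <= t n) ->
  (fun n => ratio n * ln (Zle (E n) (lam n) (t n))) @ \oo --> l ->
  (fun n => ratio n * ln (probXle (E n) (p n) (t n))) @ \oo --> l - c.
Proof.
move=> t0 hl; have h := cvgD hl (cvg_ln_empty Etree p01 pD).
have e : {near \oo, (fun n => ratio n * ln (Zle (E n) (lam n) (t n)) + D n * ln (1 - p n))
   =1 (fun n => ratio n * ln (probXle (E n) (p n) (t n)))}.
  apply: filterS3 p_lt1' Npos lam_ge0 => n p1 Nn l0 /=.
  have q0 : 0 < 1 - p n by rewrite subr_gt0.
  have Z0 : 0 < Zle (E n) (lam n) (t n).
    exact: lt_le_trans (Zle_ge1 k_ge2 (Eunif n) l0 (t0 n)).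
  rewrite probXle_odds // lnM ?posrE ?exprn_gt0 // lnXn // mulrDr addrC.
  congr (_ + _); rewrite /ratio -[ln _ *+ _]mulr_natl mulrA divfK //.
  by rewrite pnatr_eq0 -lt0n.
exact: cvg_trans (near_eq_cvg e) (h _).
Qed.

(** Applies [Zle_lower] with [t'] the typical edge count at tilt [z2]. The tangent inequalities at
    [z] and [z2] are strict, so on the scale [N / D] each subtracted term is exponentially smaller
    than [Zpart] at [z1], hence eventually at most a quarter of it. *)
Lemma tilted_limit_ge (z z1 z2 x x1 x2 d : R) (t : nat -> R) :
  0 <= z -> z < z1 -> z1 < z2 -> z2 < 1 -> 0 < x -> 0 < x1 -> 0 < x2 ->
  activity k z x = c -> activity k z1 x1 = c -> activity k z2 x2 = c ->
  uniqueness k z x -> uniqueness k z1 x1 -> uniqueness k z2 x2 ->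
  (forall n, 0 <= t n) ->
  (fun n => ratio n * t n) @ \oo --> (1 - z) * x ^+ k / k%:R -> 0 < d ->
  \forall n \near \oo, 
    free_energy k z1 x1 - ln (1 - z1) * ((1 - z2) * x2 ^+ k / k%:R) - d <=
    ratio n * ln (Zle (E n) (lam n) (t n)).
Proof.
move=> z0 zz1 z12 z21 x0 x10 x20 ax ax1 ax2 ux ux1 ux2 t0 ht d0.
have z11 : z1 < 1 by exact: lt_trans z21.
have zl1 : z < 1 by exact: lt_trans z11.
have z10 : 0 <= z1 by apply: ltW; exact: le_lt_trans zz1.
have z20 : 0 <= z2 by apply: ltW; exact: le_lt_trans z12.
have g1 : free_energy k z x + (1 - z) * x ^+ k / k%:R * (ln (1 - z1) - ln (1 - z))
    < free_energy k z1 x1.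
  by apply: free_energy_tangent => //; [rewrite lt_eqF | rewrite ax ax1].
have g2 : free_energy k z2 x2 + (1 - z2) * x2 ^+ k / k%:R * (ln (1 - z1) - ln (1 - z2))
    < free_energy k z1 x1.
  by apply: free_energy_tangent => //; [rewrite gt_eqF | rewrite ax1 ax2].
set tau2 := (1 - z2) * x2 ^+ k / k%:R in g2 *.
set th1 := ln (1 - z1) in g1 g2 *; set th := ln (1 - z) in g1; set th2 := ln (1 - z2) in g2.
have bz : 0 <= z <= 1 by rewrite z0 ltW.
have bz1 : 0 <= z1 <= 1 by rewrite z10 ltW.
have bz2 : 0 <= z2 <= 1 by rewrite z20 ltW.
have cA := scaled_lnZ_odds_cvg bz1 x10 ax1 ux1.
have cB := scaled_lnZ_odds_cvg bz x0 ax ux.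
have cC := scaled_lnZ_odds_cvg bz2 x20 ax2 ux2.
pose A n := ratio n * ln (Zpart (E n) (lam n) z1).
pose B n := ratio n * ln (Zpart (E n) (lam n) z).
pose C n := ratio n * ln (Zpart (E n) (lam n) z2).
have c4 : (fun n => ratio n * ln 4) @ \oo --> (0 : R).
  by rewrite -[X in _ --> X](mul0r (ln 4)); apply: cvgM => //; exact: cvg_cst.
have e1 : \forall n \near \oo, B n + (th1 - th) * (ratio n * t n) + ratio n * ln 4 < A n.
  have h : (fun n => A n - (B n + (th1 - th) * (ratio n * t n) + ratio n * ln 4)) @ \oo
     --> free_energy k z1 x1 - (free_energy k z x +
           (th1 - th) * ((1 - z) * x ^+ k / k%:R) + 0).
    apply: cvgB => //; apply: cvgD => //; apply: cvgD => //.
    by apply: cvgM => //; exact: cvg_cst.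
  have gap : 0 < free_energy k z1 x1 - (free_energy k z x +
           (th1 - th) * ((1 - z) * x ^+ k / k%:R) + 0).
    by rewrite addr0 subr_gt0 mulrC.
  by apply: filterS (cvgr_gt _ h _ gap) => n; rewrite subr_gt0.
have e2 : \forall n \near \oo, C n + (th1 - th2) * tau2 + ratio n * ln 4 < A n.
  have h : (fun n => A n - (C n + (th1 - th2) * tau2 + ratio n * ln 4)) @ \oo
     --> free_energy k z1 x1 - (free_energy k z2 x2 + (th1 - th2) * tau2 + 0).
    apply: cvgB => //; apply: cvgD => //; apply: cvgD => //.
    exact: cvg_cst.
  have gap : 0 < free_energy k z1 x1 - (free_energy k z2 x2 + (th1 - th2) * tau2 + 0).
    by rewrite addr0 subr_gt0 mulrC.
  by apply: filterS (cvgr_gt _ h _ gap) => n; rewrite subr_gt0.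
have e3 : \forall n \near \oo, free_energy k z1 x1 - d < A n - ratio n * ln 4.
  have h : (fun n => A n - ratio n * ln 4) @ \oo --> free_energy k z1 x1 - 0.
    exact: cvgB.
  have gap : free_energy k z1 x1 - d < free_energy k z1 x1 - 0 by rewrite subr0 gtrBl.
  exact: cvgr_gt _ h _ gap.
near=> n.
have rn : 0 < ratio n by near: n; exact: ratio_gt0.
have ln0 : 0 <= lam n by near: n; exact: lam_ge0.
have f1 : B n + (th1 - th) * (ratio n * t n) + ratio n * ln 4 < A n by near: n.
have f2 : C n + (th1 - th2) * tau2 + ratio n * ln 4 < A n by near: n.
have f3 : free_energy k z1 x1 - d < A n - ratio n * ln 4 by near: n.
pose t' := tau2 / ratio n.
have rt' : ratio n * t' = tau2 by rewrite mulrC divfK // gt_eqF.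
have Zpos zz : 0 <= zz <= 1 -> 0 < Zpart (E n) (lam n) zz.
  by move=> b; exact: lt_le_trans (Zpart_ge1 k_gt0 (Eunif n) ln0 b).
have p1 := Zpos _ bz1; have p0 := Zpos _ bz; have p2 := Zpos _ bz2.
have four0 : (0 : R) < 4 by rewrite ltr0n.
have Zl0 : 0 < Zle (E n) (lam n) (t n).
  exact: lt_le_trans (Zle_ge1 k_ge2 (Eunif n) ln0 (t0 n)).
have q1 : expR ((th1 - th) * t n) * Zpart (E n) (lam n) z <= Zpart (E n) (lam n) z1 / 4.
  rewrite -ler_ln ?posrE ?mulr_gt0 ?expR_gt0 ?invr_gt0 //.
  rewrite lnM ?posrE ?expR_gt0 // expRK ln_div ?posrE //.
  rewrite -(ler_pM2l rn) mulrDr mulrBr lerBrDr [_ * (_ * t n)]mulrCA.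
  by apply/ltW; move: f1; rewrite [B n + _]addrC.
have q2 : expR ((th1 - th2) * t') * Zpart (E n) (lam n) z2 <= Zpart (E n) (lam n) z1 / 4.
  rewrite -ler_ln ?posrE ?mulr_gt0 ?expR_gt0 ?invr_gt0 //.
  rewrite lnM ?posrE ?expR_gt0 // expRK ln_div ?posrE //.
  rewrite -(ler_pM2l rn) mulrDr mulrBr lerBrDr [_ * (_ * t')]mulrCA rt'.
  by apply/ltW; move: f2; rewrite [C n + _]addrC.
have L := Zle_lower (E n) (t n) t' ln0 z0 zz1 z12 z21.
rewrite -/th1 -/th -/th2 in L.
have M : expR (- (th1 * t')) * (Zpart (E n) (lam n) z1 / 4) <= Zle (E n) (lam n) (t n).
  apply: le_trans L; rewrite ler_wpM2l ?expR_ge0 //.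
  exact: quarter_arith p1 q1 q2.
move: M; rewrite -ler_ln ?posrE ?mulr_gt0 ?expR_gt0 ?invr_gt0 //.
rewrite lnM ?posrE ?expR_gt0 ?mulr_gt0 ?invr_gt0 // expRK ln_div ?posrE //.
move=> /(ler_wpM2l (ltW rn)); apply: le_trans.
rewrite mulrDr mulrBr mulrN [ratio n * (th1 * t')]mulrCA rt' -/(A n).
by rewrite addrAC addrC lerD2l ltW.
Unshelve. all: by end_near. Qed.

Lemma Zle_limit (z x eta : R) : 0 < eta -> 0 <= z < 1 -> 0 < x ->
  activity k z x = c -> uniqueness k z x -> (1 - z) * x ^+ k = eta * c ^+ k ->
  (fun n => ratio n * ln (Zle (E n) (lam n) (eta * (#|E n|%:R * p n ^+ k)))) @ \oo -->
    free_energy k z x - ln (1 - z) * (eta * c ^+ k / k%:R).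
Proof.
move=> eta0 /andP[z0 z1] x0 ax ux zeq.
pose t n := eta * (#|E n|%:R * p n ^+ k).
have t0 n : 0 <= t n.
  by rewrite mulr_ge0 ?(ltW eta0) // mulr_ge0 // exprn_ge0 //; case/andP: (p01 n).
have ht : (fun n => ratio n * t n) @ \oo --> eta * c ^+ k / k%:R.
  rewrite (_ : (fun n => _) = (fun n => eta * (ratio n * (#|E n|%:R * p n ^+ k)))).
    rewrite -mulrA; apply: cvgM; first exact: cvg_cst.
    exact: cvg_expected_edges k_ge2 Eunif Etree Npos pD.
  by apply/funext => n; rewrite /t mulrCA.
set tau := eta * c ^+ k / k%:R in ht *; set th := ln (1 - z).
have th0 : th <= 0 by apply: ln_le0; rewrite gerBl.
have bz : 0 <= z <= 1 by rewrite z0 ltW.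
apply/cvgrPdist_le => d d0.
have up : \forall n \near \oo, ratio n * ln (Zle (E n) (lam n) (t n)) <=
    free_energy k z x - th * tau + d.
  have h : (fun n => - (th * (ratio n * t n)) + ratio n * ln (Zpart (E n) (lam n) z)) @ \oo
     --> - (th * tau) + free_energy k z x.
    apply: cvgD; last exact: scaled_lnZ_odds_cvg.
    by apply: cvgN; apply: cvgM => //; exact: cvg_cst.
  have gap : - (th * tau) + free_energy k z x < free_energy k z x - th * tau + d.
    by rewrite addrC ltrDl.
  apply: filterS3 (cvgr_lt _ h _ gap) ratio_gt0 lam_ge0 => n hn rn ln0.
  apply: le_trans (ltW hn).
  have Zl0 : 0 < Zle (E n) (lam n) (t n).
    exact: lt_le_trans (Zle_ge1 k_ge2 (Eunif n) ln0 (t0 n)).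
  have Z0 : 0 < Zpart (E n) (lam n) z.
    exact: lt_le_trans (Zpart_ge1 k_gt0 (Eunif n) ln0 bz).
  have := Zle_upper (E n) (t n) ln0 z0 z1; rewrite -/th.
  rewrite -ler_ln ?posrE ?mulr_gt0 ?expR_gt0 // lnM ?posrE ?expR_gt0 // expRK.
  by move=> /(ler_wpM2l (ltW rn)); rewrite mulrDr mulrN [ratio n * (th * _)]mulrCA.
have low : \forall n \near \oo, free_energy k z x - th * tau - d <=
    ratio n * ln (Zle (E n) (lam n) (t n)).
  (* A shortfall [d1] at the lower end of the window costs [- ln (1 - z1)] times [d1]; for [z1] near
     [z] that factor is below [1 - th], so the cost is at most [d / 2]. *)
  pose d1 := d / 2 / (1 - th).
  have th1 : 0 < 1 - th by rewrite subr_gt0 (le_lt_trans th0).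
  have d10 : 0 < d1 by rewrite !divr_gt0.
  have ct := @cvg_tilt R k c x c_gt0 x0.
  have tx : tilt k c x = z by rewrite -ax tilt_activity.
  rewrite tx in ct.
  have c1 : 1 - tilt k c y @[y --> x] --> 1 - z by apply: cvgB => //; exact: cvg_cst.
  have c2 : (1 - tilt k c y) * y ^+ k / k%:R @[y --> x] --> tau.
    rewrite /tau -zeq; apply: cvgM; last exact: cvg_cst.
    by apply: cvgM => //; exact: exprn_continuous.
  have cl : ln u @[u --> 1 - z] --> th by apply: continuous_ln; rewrite subr_gt0.
  have c3 : ln (1 - tilt k c y) @[y --> x] --> th.
    exact: (@cvg_comp _ _ _ (fun y => 1 - tilt k c y) (fun u => ln u) _ _ _ c1 cl).
  have c4 : k.-1%:R * tilt k c y * c ^+ k.-1 @[y --> x] --> k.-1%:R * z * c ^+ k.-1.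
    apply: cvgM; last exact: cvg_cst.
    by apply: cvgM => //; exact: cvg_cst.
  have uz : k.-1%:R * z * c ^+ k.-1 < expR 1 by rewrite -[in X in X < _]ax.
  have ci : y @[y --> x] --> x by exact: cvg_id.
  have n0 : \forall y \near x, 0 < y by exact: (cvgr_gt x ci _ x0).
  have n1 : \forall y \near x, tilt k c y < 1 by exact: (cvgr_lt z ct _ z1).
  have n2 : \forall y \near x, k.-1%:R * tilt k c y * c ^+ k.-1 < expR 1.
    exact: (cvgr_lt _ c4 _ uz).
  have n3 : \forall y \near x, th - 1 < ln (1 - tilt k c y).
    have h : th - 1 < th by rewrite gtrBl.
    exact: (cvgr_gt _ c3 _ h).
  have n4 : \forall y \near x, tau - d1 < (1 - tilt k c y) * y ^+ k / k%:R.
    have h : tau - d1 < tau by rewrite gtrBl.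
    exact: (cvgr_gt _ c2 _ h).
  have : \forall y \near x, [/\ 0 < y, tilt k c y < 1,
     k.-1%:R * tilt k c y * c ^+ k.-1 < expR 1, th - 1 < ln (1 - tilt k c y) &
     tau - d1 < (1 - tilt k c y) * y ^+ k / k%:R].
    by near=> y; split; near: y.
  move=> /nbhs_ballP[e /= e0 he].
  (* At fixed activity a lower density means a larger tilt, so [x2 < x1 < x] yields tilts increasing
     from [z]. *)
  have [x10 z11 u1 th1' _] := he (x - e / 4) (ltac:(by rewrite /ball /= opprB addrC subrK gtr0_norm; lra)).
  have [x20 z21 u2 _ tau2] := he (x - e / 2) (ltac:(by rewrite /ball /= opprB addrC subrK gtr0_norm; lra)).
  set x1 := x - e / 4 in x10 z11 u1 th1'; set x2 := x - e / 2 in x20 z21 u2 tau2.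
  have x1x : x1 < x by rewrite /x1; lra.
  have x21 : x2 < x1 by rewrite /x1 /x2; lra.
  have a1 := @activity_tilt R k c x1 c_gt0 x10.
  have a2 := @activity_tilt R k c x2 c_gt0 x20.
  have zz1 : z < tilt k c x1 by apply: (@tilt_anti R k _ _ _ _ z0 x10 x1x); rewrite a1 ax.
  have z12 : tilt k c x1 < tilt k c x2.
    apply: (@tilt_anti R k _ _ _ _ _ x20 x21); last by rewrite a1 a2.
    by apply: ltW; exact: le_lt_trans zz1.
  have ux1 : uniqueness k (tilt k c x1) x1 by rewrite /uniqueness a1.
  have ux2 : uniqueness k (tilt k c x2) x2 by rewrite /uniqueness a2.
  have d2 : 0 < d / 2 by rewrite divr_gt0.
  have ht' : (fun n => ratio n * t n) @ \oo --> (1 - z) * x ^+ k / k%:R by rewrite zeq.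
  have := tilted_limit_ge z0 zz1 z12 z21 x0 x10 x20 ax a1 a2 ux ux1 ux2 t0 ht' d2.
  apply: filterS => n; apply: le_trans.
  have tg : free_energy k z x + (1 - z) * x ^+ k / k%:R * (ln (1 - tilt k c x1) - ln (1 - z))
      < free_energy k (tilt k c x1) x1.
    apply: free_energy_tangent => //; [ | by rewrite lt_eqF | by rewrite ax a1].
    by apply: ltW; exact: le_lt_trans zz1.
  rewrite zeq -/tau -/th in tg.
  have th10 : ln (1 - tilt k c x1) <= 0.
    by apply: ln_le0; rewrite gerBl; apply: ltW; exact: le_lt_trans zz1.
  have hd : (1 - th) * d1 = d / 2 by rewrite /d1 mulrC divfK // gt_eqF.
  exact: tilted_limit_arith tg tau2 th1' th10 hd d10.
apply: filterS2 up low => n h1 h2.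
rewrite ler_norml; apply/andP; split.
  by rewrite lerBrDr addrC lerBlDr.
by rewrite lerBlDr -lerBlDl.
Unshelve. all: by end_near. Qed.
End LowerTailLimit.

(** * The Lambert function and the parameter zeta *)

Section Roots.
Variables (R : realType) (m : nat).
Hypothesis m_gt0 : (0 < m)%N.

Lemma powR_rootK (a : R) : 0 <= a -> (powR a m%:R^-1) ^+ m = a.
Proof.
move=> a0; rewrite -powR_mulrn ?powR_ge0 // -powRrM mulVf ?powRr1 //.
by rewrite pnatr_eq0 -lt0n.
Qed.

Lemma powR_root_expn (a : R) (j : nat) : powR a (j%:R / m%:R) = (powR a m%:R^-1) ^+ j.
Proof. by rewrite -powR_mulrn ?powR_ge0 // -powRrM mulrC. Qed.

Lemma expn_lt_powR_root (a c : R) : 0 <= c -> 0 <= a -> c < powR a m%:R^-1 -> c ^+ m < a.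
Proof.
by move=> c0 a0 h; rewrite -[ltRHS]powR_rootK // ltrXn2r ?nnegrE ?powR_ge0 // -lt0n.
Qed.
End Roots.

Section LambertSolution.
Variables (R : realType) (k : nat).
Hypothesis k_ge2 : (2 <= k)%N.
Local Notation act := (activity k).

Let k_gt0 : (0 < k)%N. Proof. exact: leq_trans k_ge2. Qed.
Let k1_gt0 : (0 < k.-1)%N. Proof. by rewrite -subn1 subn_gt0. Qed.
Let k1R : 0 < k.-1%:R :> R. Proof. by rewrite ltr0n. Qed.

Lemma lambertW_spec (y : R) : 0 <= y ->
  0 <= lambertW y /\ lambertW y * expR (lambertW y) = y.
Proof.
move=> y0.
have [||x] := @IVT R (fun x => x * expR x) 0 y y y0.
- apply: continuous_subspaceT => x.
  by apply: cvgM; [exact: cvg_id | exact: continuous_expR].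
- rewrite mul0r ge_min y0 /= le_max; apply/orP; right.
  by rewrite ler_peMr // -[leLHS]expR0 ler_expR.
rewrite in_itv /= => /andP[x0 _] hx.
have : [set x : R | 0 <= x /\ x * expR x = y] (lambertW y).
  by apply: xgetPex; exists x.
by [].
Qed.

Lemma activity_expn z (x : R) : act z x ^+ k.-1 = x ^+ k.-1 * expR (k.-1%:R * z * x ^+ k.-1).
Proof. by rewrite exprMn -expRM_natl mulrA. Qed.

(** For [w = (k-1) z x^(k-1)], raising [act z x = c] to the power [k - 1] and multiplying by
    [(k-1) z] gives [w e^w = (k-1) c^(k-1) z], the equation of the Lambert function. *)
Lemma xstar_spec (c z : R) : 0 < c -> 0 <= z ->
  0 < xstar k c z /\ act z (xstar k c z) = c.
Proof.
move=> c0 z0; rewrite /xstar; case: eqVneq => [->|zn0].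
  by rewrite /activity mul0r expR0 mulr1.
have zp : 0 < z by rewrite lt_neqAle eq_sym zn0.
set w := lambertW _.
have Y0 : 0 < k.-1%:R * c ^+ k.-1 * z by rewrite !mulr_gt0 // exprn_gt0.
have [w0 hw] := lambertW_spec (ltW Y0); rewrite -/w in w0 hw.
have wp : 0 < w.
  rewrite lt_neqAle w0 andbT; apply/eqP => e; move: Y0; rewrite -hw -e mul0r.
  by rewrite ltxx.
have mz : 0 < k.-1%:R * z by rewrite mulr_gt0.
have q0 : 0 < w / (k.-1%:R * z) by rewrite divr_gt0.
have x0 : 0 < powR (w / (k.-1%:R * z)) k.-1%:R^-1 by rewrite powR_gt0.
split=> //; apply/eqP; rewrite -(@eqrXn2 _ k.-1) ?(ltW c0) //; last first.
  exact/ltW/activity_gt0.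
have e : k.-1%:R * z * (w / (k.-1%:R * z)) = w by rewrite mulrC divfK // gt_eqF.
rewrite activity_expn powR_rootK ?(ltW q0) // e mulrAC hw; apply/eqP.
by field; rewrite !gt_eqF.
Qed.

Lemma activity_inj z (x y : R) : 0 <= z -> 0 < x -> 0 < y -> act z x = act z y -> x = y.
Proof.
move=> z0 x0 y0 h; have [xy|xy|//] := ltgtP x y.
  by have := activity_lt k z0 x0 xy; rewrite h ltxx.
by have := activity_lt k z0 y0 xy; rewrite h ltxx.
Qed.

(** At fixed [c], a larger [zeta] gives a smaller density, so [(1 - zeta) x^k] is strictly
    decreasing in [zeta]. *)
Lemma zeta_unique (c eta z z' : R) : 0 < c ->
  0 <= z <= 1 -> (1 - z) * xstar k c z ^+ k = eta * c ^+ k ->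
  0 <= z' <= 1 -> (1 - z') * xstar k c z' ^+ k = eta * c ^+ k -> z = z'.
Proof.
move=> c0; wlog zz' : z z' / z < z'.
  move=> H h1 h2 h3 h4; have [zz'|zz'|//] := ltgtP z z'; first exact: H zz' h1 h2 h3 h4.
  by apply/esym; exact: H zz' h3 h4 h1 h2.
move=> /andP[z0 z1] h1 /andP[z'0 z'1] h2.
have [x0 ax] := xstar_spec c0 z0; have [x'0 ax'] := xstar_spec c0 z'0.
move: h1 h2 x0 ax x'0 ax'; move: (xstar k c z) (xstar k c z') => x x' h1 h2 x0 ax x'0 ax'.
have xx' : x' < x.
  rewrite ltNge; apply/negP => xx'.
  have a1 := activity_le k z0 x0 xx'.
  have : act z x' < act z' x'.
    by rewrite ltr_pM2l // ltr_expR ltr_pM2r // exprn_gt0.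
  by rewrite ax' -ax => /(le_lt_trans a1); rewrite ltxx.
have : (1 - z') * x' ^+ k < (1 - z) * x ^+ k.
  apply: (@le_lt_trans _ _ ((1 - z') * x ^+ k)).
    by rewrite ler_wpM2l ?subr_ge0 // lerXn2r ?nnegrE ?ltW.
  by rewrite ltr_pM2r ?exprn_gt0 // ltrD2l ltrN2.
by rewrite h1 h2 ltxx.
Qed.

(* zeta is parametrized by x through tilt, so the intermediate value theorem is applied
   in the variable x rather than to the implicitly defined xstar. *)
Lemma zeta_exists (c eta : R) : 0 < c -> 0 <= eta -> eta < 1 ->
  exists z : R, 0 <= z <= 1 /\ (1 - z) * xstar k c z ^+ k = eta * c ^+ k.
Proof.
move=> c0 eta0 eta1; have [x10 ax1] := xstar_spec c0 ler01.
set x1 := xstar k c 1 in x10 ax1.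
have x1c : x1 <= c.
  rewrite -ax1 ler_peMr ?(ltW x10) // -[leLHS]expR0 ler_expR mul1r exprn_ge0 //.
  exact: ltW.
pose h (y : R) := (1 - tilt k c y) * y ^+ k.
have ck : 0 < c ^+ k by exact: exprn_gt0.
(* The endpoints [x1] and [c] have tilts 1 and 0, hence values 0 and [c^k], which enclose
   [eta c^k]. *)
have [||x] := @IVT R h x1 c (eta * c ^+ k) x1c.
- apply: (@continuous_in_subspaceT _ _ `[x1, c] h) => y.
  rewrite inE /= in_itv /= => /andP[xy _].
  have y0 : 0 < y by exact: lt_le_trans xy.
  apply: cvgM; last exact: exprn_continuous.
  by apply: cvgB; [exact: cvg_cst | exact: cvg_tilt].
- have -> : h x1 = 0 by rewrite /h -{1}ax1 tilt_activity // subrr mul0r.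
  have -> : h c = c ^+ k by rewrite /h /tilt divff ?gt_eqF // ln1 mul0r subr0 mul1r.
  rewrite ge_min le_max mulr_ge0 ?(ltW ck) //=; apply/orP; right.
  by rewrite ler_piMl ?ltW.
rewrite in_itv /= => /andP[x1x xc] hx.
have x0 : 0 < x by exact: lt_le_trans x1x.
have z0 : 0 <= tilt k c x.
  rewrite divr_ge0 ?exprn_ge0 ?(ltW x0) // ln_ge0 // ler_pdivlMr // mul1r //.
exists (tilt k c x); split.
  rewrite z0 /= -subr_ge0 -(pmulr_lge0 _ (exprn_gt0 k x0)) -/(h x) hx.
  by rewrite mulr_ge0 // ltW.
have [y0 ay] := xstar_spec c0 z0.
by rewrite (@activity_inj _ (xstar k c (tilt k c x)) x z0 y0 x0) // ay activity_tilt.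
Qed.

(** Origin of [eta_star]. For [y = (k-1) z x^(k-1)] one has [y e^y = (k-1) z c^(k-1)] and
    [(x / c)^k = exp (- k y / (k-1))]. If the conclusion fails, then [y >= 1], so
    [(x / c)^k <= eta_star] and [eta <= (1 - z) eta_star]. Thus [z <= 1 - eta / eta_star], and the
    bound on [c] yields the conclusion after all. *)
Lemma uniqueness_of_lt_cbar (c eta z : R) : 0 < c -> 0 <= z <= 1 ->
  (1 - z) * xstar k c z ^+ k = eta * c ^+ k -> lt_cbar k eta c ->
  k.-1%:R * z * c ^+ k.-1 < expR 1.
Proof.
move=> c0 /andP[z0 z1] hz cbar; rewrite ltNge; apply/negP => eC.
have [x0 ax] := xstar_spec c0 z0; move: hz x0 ax; move: (xstar k c z) => x hz x0 ax.
have ck : 0 < c ^+ k by exact: exprn_gt0.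
have zp : 0 < z.
  rewrite lt_neqAle z0 andbT; apply/eqP => ze; move: eC; rewrite -ze mulr0 mul0r.
  by rewrite leNgt expR_gt0.
pose y := k.-1%:R * z * x ^+ k.-1.
have y0 : 0 <= y by rewrite !mulr_ge0 // exprn_ge0 // ltW.
have ye : y * expR y = k.-1%:R * z * c ^+ k.-1.
  by rewrite -ax activity_expn /y !mulrA.
have y1 : 1 <= y.
  rewrite leNgt; apply/negP => y1; move: eC; rewrite -ye; apply/negP; rewrite -ltNge.
  apply: (@le_lt_trans _ _ (y * expR 1)).
    by rewrite ler_wpM2l // ler_expR ltW.
  by rewrite gtr_pMl ?expR_gt0.
have xk : x ^+ k <= c ^+ k * eta_star R k.
  rewrite -ax exprMn -expRM_natl /eta_star -mulrA -expRD.
  rewrite ler_peMr ?exprn_ge0 ?(ltW x0) // -[leLHS]expR0 ler_expR subr_ge0.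
  have -> : k%:R * (z * x ^+ k.-1) = k%:R / k.-1%:R * y.
    by rewrite /y -[X in _ = _ * X]mulrA [RHS]mulrA divfK ?gt_eqF.
  by rewrite ler_peMr // divr_ge0.
have es0 : 0 < eta_star R k by exact: expR_gt0.
have he : eta <= (1 - z) * eta_star R k.
  rewrite -(ler_pM2r ck) -hz -mulrA ler_wpM2l ?subr_ge0 //.
  by rewrite [leRHS]mulrC.
have hlt : eta < eta_star R k.
  by apply: (le_lt_trans he); rewrite gtr_pMl // gtrBl.
have hq : z <= 1 - eta / eta_star R k.
  by rewrite lerBrDr -lerBrDl ler_pdivrMr.
have hq0 : 0 < 1 - eta / eta_star R k by exact: lt_le_trans hq.
have := cbar hlt; move/expn_lt_powR_root => /(_ k1_gt0 (ltW c0)) H.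
have d0 : 0 < k.-1%:R * (1 - eta / eta_star R k) by rewrite mulr_gt0.
have := H (divr_ge0 (expR_ge0 _) (ltW d0)); rewrite ltr_pdivlMr // => H2.
have : c ^+ k.-1 * (k.-1%:R * z) < expR 1.
  apply: le_lt_trans H2; rewrite ler_wpM2l ?exprn_ge0 ?(ltW c0) //.
  by rewrite ler_wpM2l ?(ltW k1R).
by rewrite mulrC ltNge eC.
Qed.
End LambertSolution.

(** * From the asymptotic hypotheses to [near_treelike] *)

Section FromAsymptoticallyTreelike.
Variables (R : realType) (k : nat).
Hypothesis k_ge2 : (2 <= k)%N.

Let k1_gt0 : (0 < k.-1)%N. Proof. by rewrite -subn1 subn_gt0. Qed.

Lemma codeg_le_maxdeg n (E : {set {set 'I_n}}) u : (codeg E [set u]%SET <= maxdeg E)%N.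
Proof.
by rewrite /maxdeg; have := codeg_max E [set u]%SET; rewrite cards1.
Qed.

Lemma mindeg_le_codeg n (E : {set {set 'I_n}}) u : (mindeg E <= codeg E [set u]%SET)%N.
Proof.
rewrite /mindeg; have := mem_index_enum u.
elim: (index_enum _) => // v r IH; rewrite inE big_cons geq_min => /orP[/eqP->|/IH->].
  by rewrite leqnn.
by rewrite orbT.
Qed.

Lemma maxdeg_gt0_order n (E : {set {set 'I_n}}) : (0 < maxdeg E)%N -> (0 < n)%N.
Proof.
case: n E => // E; rewrite /maxdeg /maxcodeg big_pred0 // => S.
apply/negbTE; rewrite neq_ltn; apply/orP; left.
by rewrite ltnS -[leqRHS]card_ord max_card.
Qed.

Variables (N : nat -> nat) (E : forall n : nat, {set {set 'I_(N n)}}).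
Hypothesis degree_large : forall M : R, \forall n \near \oo, M <= (maxdeg (E n))%:R.
Hypothesis codegree_small : forall l : nat, (2 <= l)%N -> (l <= k.-1)%N ->
     forall eps : R, 0 < eps -> \forall n \near \oo,
       (maxcodeg (E n) l)%:R
         <= eps * powR (maxdeg (E n))%:R ((k - l)%:R / k.-1%:R).
Hypothesis Gamma_small : forall eps : R, 0 < eps -> \forall n \near \oo,
       (Gamma (E n) k)%:R <= eps * (maxdeg (E n))%:R.
Hypothesis nearly_regular : forall eps : R, 0 < eps -> \forall n \near \oo,
       (1 - eps) * (maxdeg (E n))%:R <= (mindeg (E n))%:R.

Let D n : R := powR (maxdeg (E n))%:R k.-1%:R^-1.

Lemma vertices_eventually : \forall n \near \oo, (0 < N n)%N.
Proof.
apply: filterS (degree_large 1) => n h; apply: (@maxdeg_gt0_order _ (E n)).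
by move: h; rewrite -[X in X <= _]/(1%:R) ler_nat.
Qed.

Lemma eventually_near_treelike (eps : R) : 0 < eps ->
  \forall n \near \oo, near_treelike k (E n) (D n) eps.
Proof.
move=> e0.
have DX n : D n ^+ k.-1 = (maxdeg (E n))%:R by rewrite powR_rootK.
have cod : \forall n \near \oo, forall l : 'I_k, (2 <= l)%N ->
     (maxcodeg (E n) l)%:R <= eps * D n ^+ (k - l).
  apply: filter_forall => l.
  have [l2|l1] := leqP 2 l; last by apply: nearW => n.
  have lk : (l <= k.-1)%N by rewrite -ltnS (ltn_predK k_ge2).
  by apply: filterS (codegree_small l2 lk e0) => n h _; rewrite -powR_root_expn.
(* A maximum degree of at least [eps^-(k-1)] is what [1 <= eps * D] requires. *)
apply: filterS3 (degree_large (eps^-1 ^+ k.-1)) cod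
   (filterI (Gamma_small e0) (nearly_regular e0)) => n h1 h2 [h3 h4].
split.
- rewrite -ler_pdivrMl // mulr1 -(@ler_pXn2r _ k.-1) ?nnegrE ?invr_ge0 ?powR_ge0 ?(ltW e0) //.
  by rewrite DX.
- move=> l l2 lk; have lk' : (l < k)%N by rewrite -(ltn_predK k_ge2) ltnS.
  exact: h2 (Ordinal lk') l2.
- by rewrite DX.
- by move=> u; rewrite DX ler_nat codeg_le_maxdeg.
- by move=> u; rewrite DX (le_trans h4) // ler_nat mindeg_le_codeg.
Qed.
End FromAsymptoticallyTreelike.

Theorem mainTheorem6 (R : realType) (k : nat) (c : R)
  (N : nat -> nat) (E : forall n : nat, {set {set 'I_(N n)}}) (p : nat -> R) :
  (2 <= k)%N ->
  0 < c ->
  (* k-uniform *)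
  (forall n, uniform (E n) k) ->
  (* asymptotically tree-like: (1) Delta -> oo *)
  (forall M : R, \forall n \near \oo, M <= (maxdeg (E n))%:R) ->
  (* (2) Delta_l = o(Delta^{(k-l)/(k-1)}) for l = 2..k-1 *)
  (forall l : nat, (2 <= l)%N -> (l <= k.-1)%N ->
     forall eps : R, 0 < eps -> \forall n \near \oo,
       (maxcodeg (E n) l)%:R
         <= eps * powR (maxdeg (E n))%:R ((k - l)%:R / k.-1%:R)) ->
  (* (3) Gamma = o(Delta) *)
  (forall eps : R, 0 < eps -> \forall n \near \oo,
       (Gamma (E n) k)%:R <= eps * (maxdeg (E n))%:R) ->
  (* (4) |E|/|V| = Omega(Delta) *)
  (exists2 C : R, 0 < C & \forall n \near \oo,
       C * (maxdeg (E n))%:R <= #|E n|%:R / (N n)%:R) ->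
  (* approximately regular: delta = (1 - o(1)) Delta *)
  (forall eps : R, 0 < eps -> \forall n \near \oo,
       (1 - eps) * (maxdeg (E n))%:R <= (mindeg (E n))%:R) ->
  (* p is a probability with p ~ c Delta^{-1/(k-1)} *)
  (forall n, 0 <= p n <= 1) ->
  (fun n => p n / (c * powR (maxdeg (E n))%:R (- k.-1%:R^-1))) @ \oo --> (1 : R) ->
  (forall eta : R, 0 <= eta -> eta < 1 -> lt_cbar k eta c ->
  (* zeta: unique solution in [0,1] of (1-zeta) x_k^*(c,zeta)^k = eta c^k *)
  (exists zeta : R, 0 <= zeta <= 1 /\ (1 - zeta) * xstar k c zeta ^+ k = eta * c ^+ k) /\
  (forall zeta zeta' : R,
     0 <= zeta <= 1 -> (1 - zeta) * xstar k c zeta ^+ k = eta * c ^+ k ->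
     0 <= zeta' <= 1 -> (1 - zeta') * xstar k c zeta' ^+ k = eta * c ^+ k ->
     zeta = zeta') /\
  (forall zeta : R,
     0 <= zeta <= 1 -> (1 - zeta) * xstar k c zeta ^+ k = eta * c ^+ k ->
     (fun n => powR (maxdeg (E n))%:R k.-1%:R^-1 / (N n)%:R
                 * ln (probXle (E n) (p n) (eta * (#|E n|%:R * p n ^+ k))))
       @ \oo -->
     (xstar k c zeta + xstar k c zeta ^+ k * (1 - k%:R^-1) * zeta
       - (if eta == 0 then 0 else ln (1 - zeta) * eta * c ^+ k / k%:R)
       - c : R))) /\
  (* in particular, the case X = 0 *)
  (c < powR (expR 1 / k.-1%:R) k.-1%:R^-1 ->
     (fun n => powR (maxdeg (E n))%:R k.-1%:R^-1 / (N n)%:R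
                 * ln (probX0 (E n) (p n)))
       @ \oo -->
     (xstar k c 1 + (1 - k%:R^-1) * xstar k c 1 ^+ k - c : R)).
Proof.
move=> k2 c0 unif large cod gam _ reg p01 hp.
have k1_gt0 : (0 < k.-1)%N by rewrite -subn1 subn_gt0.
have k_gt0 : (0 < k)%N by exact: leq_trans k2.
have k1R : 0 < k.-1%:R :> R by rewrite ltr0n.
pose D n : R := powR (maxdeg (E n))%:R k.-1%:R^-1.
have tree (eps : R) : 0 < eps -> \forall n \near \oo, near_treelike k (E n) (D n) eps.
  exact: eventually_near_treelike.
have Npos := vertices_eventually large.
have pD : (fun n => p n * D n) @ \oo --> c.
  have -> : (fun n => p n * D n) =
      (fun n => c * (p n / (c * powR (maxdeg (E n))%:R (- k.-1%:R^-1)))).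
    apply/funext => n; rewrite powRN -/(D n) invfM invrK mulrCA.
    by rewrite mulVKf // gt_eqF.
  by rewrite -[X in _ --> X]mulr1; apply: cvgM => //; exact: cvg_cst.
have one01 : 0 <= (1 : R) <= 1 by rewrite ler01 lexx.
(* Shared by the case [eta = 0] and the statement on [X = 0], both being the tail at threshold 0. *)
have X0limit x : 0 < x -> activity k 1 x = c -> k.-1%:R * 1 * c ^+ k.-1 < expR 1 ->
    (fun n => D n / (N n)%:R * ln (probXle (E n) (p n) 0)) @ \oo -->
      free_energy k 1 x - c.
  move=> x0 ax uC.
  apply: (probXle_cvg k2 unif tree Npos p01 pD (fun=> lexx 0)).
  have -> : (fun n => D n / (N n)%:R * ln (Zle (E n) (p n / (1 - p n)) 0)) =
      (fun n => D n / (N n)%:R * ln (Zpart (E n) (p n / (1 - p n)) 1)).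
    by apply/funext => n; rewrite Zle0_Zpart.
  apply: (scaled_lnZ_odds_cvg k2 unif tree Npos pD one01 x0 ax).
  by rewrite /uniqueness ax.
split; last first.
  move=> cC.
  have uC : k.-1%:R * 1 * c ^+ k.-1 < expR 1.
    have := expn_lt_powR_root k1_gt0 (ltW c0) (divr_ge0 (expR_ge0 _) (ltW k1R)) cC.
    by rewrite ltr_pdivlMr // mulr1 mulrC.
  have [x0 ax] := xstar_spec k2 c0 ler01.
  have := X0limit _ x0 ax uC.
  rewrite /free_energy mulr1 [X in _ + X - c]mulrC.
  by under eq_fun do rewrite -probX0_probXle.
move=> eta eta0 eta1 cbar; split; first exact: zeta_exists.
split; first by move=> z z'; exact: zeta_unique.
move=> z z01 hz.
have uC := uniqueness_of_lt_cbar k2 c0 z01 hz cbar.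
have [z0 z1] := andP z01.
have [x0 ax] := xstar_spec k2 c0 z0.
have ck : 0 < c ^+ k by exact: exprn_gt0.
have xk : 0 < xstar k c z ^+ k by exact: exprn_gt0.
(* For [eta = 0] the equation forces [zeta = 1], where the exponential tilt would involve [ln 0];
   the exact identity at threshold 0 takes its place. *)
case: eqVneq => [e0|en0].
  have ez : z = 1.
    move/eqP: hz; rewrite e0 mul0r mulf_eq0 (gt_eqF xk) orbF subr_eq0.
    by move=> /eqP.
  rewrite ez in ax x0 uC *; have := X0limit _ x0 ax uC.
  rewrite /free_energy subr0.
  rewrite (_ : (fun n => D n / _ * _) = (fun n => D n / (N n)%:R *
    ln (probXle (E n) (p n) (eta * (#|E n|%:R * p n ^+ k))))) //.
  by apply/funext => n; rewrite e0 mul0r.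
have etap : 0 < eta by rewrite lt_neqAle eq_sym en0.
have z1' : z < 1.
  rewrite -subr_gt0 -(pmulr_lgt0 _ xk) hz; exact: mulr_gt0.
have ux : uniqueness k z (xstar k c z) by rewrite /uniqueness ax.
have z01' : 0 <= z < 1 by rewrite z0.
have lim := Zle_limit k2 unif tree Npos c0 p01 pD etap z01' x0 ax ux hz.
have t0 n : 0 <= eta * (#|E n|%:R * p n ^+ k).
  by rewrite mulr_ge0 // mulr_ge0 // exprn_ge0 //; case/andP: (p01 n).
have := probXle_cvg k2 unif tree Npos p01 pD t0 lim.
have -> : ln (1 - z) * (eta * c ^+ k / k%:R) = ln (1 - z) * eta * c ^+ k / k%:R.
  by rewrite !mulrA.
exact.
Qed.
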